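(* Let $n$ be a nonnegative integer, $m\ge2$ an integer, and $f\in C^{2m-}$. Let $a\ge(m+3)/2$ be real and let $S:=\{z\in\mathbb C\colon\operatorname{Re}z\ge-a\}$. Suppose that $f:\mathbb R\to\mathbb R$ can be extended to a function (still denoted by $f$) from $\mathbb R\cup S$ into $\mathbb C$ such that $f$ is continuous on $S$, holomorphic in the interior of $S$, and $$|f(z)|\le\mu\,|z+a+1|^\lambda\quad\text{for all } z\in S,$$ for some real $\mu\in[0,\infty)$ and $\lambda\in[0,2m-1)$. Then $$|R_m|\le\frac{1.001\,\pi\,\mu\,3^\lambda}{(2m+1)(2m-1-\lambda)}\Big(\frac{\Lambda_*}4\Big)^m\frac{m^{2m+1}}{(a-m/2-1/2)^{2m-1-\lambda}}.$$ For $m=1$ (under the same conditions otherwise), the same inequality holds with $1.0331$ in place of $1.001$.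
   Context: For a natural number $\alpha$, $C^{\alpha-}$ denotes the set of all functions $f:\mathbb R\to\mathbb R$ having continuous derivatives $f^{(i)}$ of all orders $i=0,\dots,\alpha-1$ and such that $f^{(\alpha-1)}$ is absolutely continuous, with a Radon–Nikodym derivative denoted by $f^{(\alpha)}$. $\gamma_{m,j}:=(-1)^{j-1}\,\frac2j\,\binom{2m}{m+j}\big/\binom{2m}{m}$, and $$R_m:=\frac1{(2m-1)!\,2^{2m+1}}\int_0^1 ds\,(1-s)^{2m-1}\int_{-1}^{1}dv\,v^{2m}\sum_{j=1}^m\gamma_{m,j}\,j^{2m+1}\sum_{k=0}^{n-1}f^{(2m)}(k+jsv/2).$$ $\Lambda_*:=\max_{0<t<1}\Lambda(t)=0.3081\dots$, where $\Lambda(t):=(1-t)^{t-1}(1+t)^{-1-t}\,t^2$. *)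

(* Defs.v *)
From mathcomp Require Import all_boot all_order all_algebra.
From mathcomp Require Import complex.
From mathcomp Require Import all_classical all_reals all_analysis.

Set Implicit Arguments.
Unset Strict Implicit.
Unset Printing Implicit Defensive.

Import Order.TTheory GRing.Theory Num.Theory.
Import numFieldNormedType.Exports.

Local Open Scope classical_set_scope.
Local Open Scope ring_scope.
Local Open Scope complex_scope.

(* The complex numbers are R[i]^o rather than R[i] wherever their topology is
   used: that is where the library finds it, with R[i] as the field of scalars.
   Hence [derivable F z 1] for F : R[i]^o -> R[i]^o is differentiability in the
   complex sense. *)

Definition abs_continuous_on (R : realType) (a b : R) (h : R -> R) : Prop :=
  forall e : R, 0 < e -> exists2 d : R, 0 < d &
    forall (N : nat) (u v : 'I_N -> R),
      (forall i, a <= u i /\ u i <= v i /\ v i <= b) ->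
      trivIset setT (fun i => `]u i, v i[%classic) ->
      \sum_(i < N) (v i - u i) < d ->
      \sum_(i < N) `|h (v i) - h (u i)| < e.

(* On the whole line, absolute continuity is understood on every bounded
   interval. *)
Definition abs_continuous (R : realType) (h : R -> R) : Prop :=
  forall a b : R, abs_continuous_on a b h.

(* The class C^{alpha-}, for alpha >= 1. *)
Definition C_minus (R : realType) (alpha : nat) (f : R -> R) : Prop :=
  [/\ forall i, (i.+1 < alpha)%N -> forall x, derivable (derive1n i f) x 1,
      forall i, (i < alpha)%N -> continuous (derive1n i f)
    & abs_continuous (derive1n alpha.-1 f)].

(* g is a Radon-Nikodym derivative of h, i.e. a density with respect to the
   Lebesgue measure of the (locally finite, signed) Stieltjes measure of h. *)
Definition RN_derivative (R : realType) (h g : R -> R) : Prop :=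
  locally_integrable setT g /\
  forall x y : R, x <= y ->
    h y - h x = \int[@lebesgue_measure R]_(t in `[x, y]) g t.

Definition gamma_ (R : realType) (m j : nat) : R :=
  (-1) ^+ j.-1 * (2 / j%:R) * ('C(2 * m, m + j)%:R / 'C(2 * m, m)%:R).

(* g stands for f^{(2m)}, which is only defined almost everywhere. *)
Definition remainder (R : realType) (n m : nat) (g : R -> R) : R :=
  (((2 * m).-1)`!%:R * 2 ^+ (2 * m).+1)^-1 *
  \int[@lebesgue_measure R]_(s in `[0, 1]) ((1 - s) ^+ (2 * m).-1 *
    \int[@lebesgue_measure R]_(v in `[-1, 1]) (v ^+ (2 * m) *
      \sum_(1 <= j < m.+1) (gamma_ R m j * j%:R ^+ (2 * m).+1 *
        \sum_(0 <= k < n) g (k%:R + j%:R * s * v / 2)))).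

Definition Lambda (R : realType) (t : R) : R :=
  (1 - t) `^ (t - 1) * (1 + t) `^ (- 1 - t) * t ^+ 2.

(* The supremum is a maximum: Lambda is continuous on ]0, 1[ with limits 0 at 0
   and 1/4 at 1, while Lambda (3/4) > 1/4. *)
Definition Lambda_max (R : realType) : R :=
  sup [set Lambda t | t in `]0, 1[%classic].

Definition half_plane (R : realType) (a : R) : set (R[i]^o) :=
  [set z : R[i]^o | - a <= complex.Re z].

Definition holomorphic_on (R : realType) (U : set (R[i]^o)) (F : R[i]^o -> R[i]^o) :
  Prop := forall z, U z -> derivable F z 1.

(* F extends f to the union of the real line and S, with the required
   regularity on S; the values of F outside this union are irrelevant. *)
Definition holo_extension (R : realType) (a : R) (f : R -> R)
    (F : R[i]^o -> R[i]^o) : Prop :=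
  [/\ forall x : R, F x%:C = (f x)%:C,
      {within half_plane a, continuous F}
    & holomorphic_on (half_plane a)^° F].

Notation cabs := ComplexField.Normc.normc.

(* Main.v *)
Require Import Defs.
From mathcomp Require Import all_boot all_order all_algebra.
From mathcomp Require Import complex.
From mathcomp Require Import all_classical all_reals all_analysis.
From mathcomp Require Import measurable_realfun.
From mathcomp Require Import ring lra zify.

(**
   Write u + iv for F on the half plane and let C_k(x) be the integral over t in
   [0, 2 pi] of Re (F (x + r e^(it)) e^(-ikt)). Goursat's subdivision argument,
   in the form of Green's identity on a rectangle, shows that C_0(x) = 2 pi f(x)
   and C_k' = (k + 1) / r C_(k+1), so the k-th derivative of f at x is
   k! C_k(x) / (2 pi r^k): this gives the smoothness of f and Cauchy's estimate
   with its sharp constant, and no power series is needed. Letting r tend to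
   x + a, |f^(2m)(x)| <= (2m)! mu 3^lam (x + a)^(lam - 2m) since
   |z + a + 1| <= 2 (x + a) + 1 <= 3 (x + a) on the circle, and by Lebesgue's
   differentiation theorem this bounds the Radon-Nikodym derivative almost
   everywhere.

   With b = a - m/2, midpoint convexity bounds the sum over k of
   (k + b)^(lam - 2m) by (b - 1/2)^(1 + lam - 2m) / (2m - 1 - lam), and it
   remains to bound the sum over j of |gamma_(m,j)| j^(2m+1). For any y > 0,
   j^(2m) <= (m / (e y))^(2m) e^(2yj), so the binomial theorem bounds the sum of
   binomial (2m, m + j) j^(2m) by (m / (e y))^(2m) (2 cosh y)^(2m). For
   y tanh y = 1 one has (cosh y / (e y))^2 = Lambda (1 / y) <= Lambda_*, and
   2 * 4^m <= pi m binomial (2m, m) for m >= 2. For m = 1 the sum is 1, and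
   1.0331 pi Lambda_* >= 1 follows from Lambda_* >= Lambda (5/6) and
   pi > 3.14151.
*)

Set Implicit Arguments.
Unset Strict Implicit.
Unset Printing Implicit Defensive.

Import Order.TTheory GRing.Theory Num.Theory.
Import numFieldNormedType.Exports.

Local Open Scope classical_set_scope.
Local Open Scope ring_scope.
Local Open Scope complex_scope.

(** * Integrals of continuous functions over segments *)

Section segment_integral.
Variable R : realType.
Implicit Types (a b c x y : R) (f g : R -> R).

Definition itg f a b : R := \int[@lebesgue_measure R]_(x in `[a, b]) f x.

(** Continuity is two-sided even at the end points: the integrands below are continuous on an open
    strip around the segment. *)
Definition cont_on f a b := forall x, a <= x <= b -> {for x, continuous f}.

Lemma cont_integrable f a b : cont_on f a b ->
  (@lebesgue_measure R).-integrable `[a, b] (EFin \o f).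
Proof.
move=> cf; apply: continuous_compact_integrable; first exact: segment_compact.
apply: continuous_in_subspaceT => x; rewrite inE/= in_itv/= => xab; exact: cf.
Qed.

Lemma itg_split f a b c : cont_on f a b -> a <= c -> c <= b ->
  itg f a b = itg f a c + itg f c b.
Proof.
move=> cf ac cb; have ii := cont_integrable cf.
rewrite /itg; have := @Rintegral_itvB _ f (BLeft a) (BRight b) c ii.
rewrite !bnd_simp => /(_ ac cb) H.
rewrite -[X in _ = _ + X]Rintegral_itv_obnd_cbnd; last first.
  by apply: integrableS ii => //; apply: subset_itvr; rewrite bnd_simp.
by rewrite -H; ring.
Qed.

Lemma itgB f g a b : cont_on f a b -> cont_on g a b ->
  itg (fun x => f x - g x) a b = itg f a b - itg g a b.
Proof. by move=> cf cg; rewrite /itg RintegralB//; exact: cont_integrable. Qed.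

Lemma itg_cst k a b : a <= b -> itg (fun=> k) a b = k * (b - a).
Proof.
move=> ab; rewrite /itg Rintegral_cst//= lebesgue_measure_itv/= lte_fin.
by move: ab; case: (ltgtP a b) => // -> _; rewrite subrr.
Qed.

Lemma cont_onB f g a b : cont_on f a b -> cont_on g a b ->
  cont_on (fun x => f x - g x) a b.
Proof. by move=> cf cg x xab; apply: cvgB; [exact: cf|exact: cg]. Qed.

Lemma cont_on_cst k a b : cont_on (fun=> k) a b.
Proof. by move=> x _; exact: cvg_cst. Qed.

(** The basic estimate of the development: it gives the error terms of Goursat's argument and, with
    [k = 0], sup bounds for integrals. *)
Lemma itg_near_cst f k (e : R) a b : a <= b -> cont_on f a b ->
  (forall x, a <= x <= b -> `|f x - k| <= e) ->
  `|itg f a b - k * (b - a)| <= e * (b - a).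
Proof.
move=> ab cf fe; rewrite -(itg_cst k ab) -itgB//; last exact: cont_on_cst.
have cfk := cont_onB cf (@cont_on_cst k a b).
apply: le_trans (le_normr_Rintegral _ _) _ => //; first exact: cont_integrable.
rewrite -(itg_cst e ab); apply: le_Rintegral => //.
- by apply: (@cont_integrable (fun x => `|f x - k|)) => x xab;
    apply: cvg_norm; exact: cfk.
by apply: (@cont_integrable (fun=> e)); exact: cont_on_cst.
Qed.

Lemma eq_itg f g a b : (forall x, a <= x <= b -> f x = g x) ->
  itg f a b = itg g a b.
Proof.
move=> fg; apply: eq_Rintegral => x; rewrite inE/= in_itv/=; exact: fg.
Qed.

Lemma itgE f a b : itg f a b = \int[@lebesgue_measure R]_(x in `[a, b]) f x.
Proof. by []. Qed.

End segment_integral.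

(* Unification must not try to compare two integrals by unfolding them. *)
#[global] Opaque itg.

(** * Green's identity for differentiable forms *)

Section green.
Variable R : realType.
Implicit Types (a b c d x y e h k lo hi : R) (f g P Q : R -> R -> R).

Definition jcont g x y := forall e, 0 < e -> exists2 d : R, 0 < d &
  forall x' y', `|x' - x| <= d -> `|y' - y| <= d -> `|g x' y' - g x y| <= e.

(** Fréchet differentiability at one point with gradient [(A, B)], the error being measured in the
    l1 norm. Nothing is said about neighbouring points, which is all that complex differentiability
    provides. *)
Definition diff2 f x y (A B : R) := forall e, 0 < e -> exists2 d : R, 0 < d &
  forall x' y', `|x' - x| <= d -> `|y' - y| <= d ->
  `|f x' y' - f x y - A * (x' - x) - B * (y' - y)| <=
  e * (`|x' - x| + `|y' - y|).

Lemma diff2_jcont f x y A B : diff2 f x y A B -> jcont f x y.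
Proof.
move=> fd e e0; have [d d0 H] := fd 1 ltr01.
have K0 : 0 < 2 + `|A| + `|B| by rewrite ltr_pwDl// ltr_pwDl.
exists (Num.min d (e / (2 + `|A| + `|B|))).
  by rewrite lt_min d0 divr_gt0.
move=> x' y'; rewrite !le_min => /andP[xd xe] /andP[yd ye].
have := H _ _ xd yd; rewrite mul1r => {}H.
set s := e / _ in xe ye.
have es : e = s + s + `|A| * s + `|B| * s.
  by rewrite /s; field; rewrite gt_eqF.
have s0 : 0 <= s by rewrite divr_ge0// ltW.
have hA : `|A * (x' - x)| <= `|A| * s by rewrite normrM ler_wpM2l.
have hB : `|B * (y' - y)| <= `|B| * s by rewrite normrM ler_wpM2l.
move: H hA hB; rewrite !ler_norml; move: es xe ye (A * _) (B * _).
by move: (`|A| * s) (`|B| * s) `|x' - x| `|y' - y| => U V X Y -> *; lra.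
Qed.

Lemma dist_continuous (u : R -> R) x :
  (forall e, 0 < e -> exists2 d : R, 0 < d &
    forall x', `|x' - x| <= d -> `|u x' - u x| <= e) ->
  {for x, continuous u}.
Proof.
move=> H; apply/cvgrPdist_le => e /H[d d0 {}H]; near=> x'.
rewrite distrC; apply: H.
by near: x'; exists d => //= z; rewrite /ball/= distrC; exact: ltW.
Unshelve. all: by end_near. Qed.

Lemma jcont_cont f x y : jcont f x y -> {for y, continuous (f x)}.
Proof.
move=> fc; apply: dist_continuous => e e0; have [d d0 H] := fc _ e0.
by exists d => // y' yd; apply: H => //; rewrite subrr normr0 ltW.
Qed.

Lemma jcontC f x y : jcont f x y -> jcont (fun y x => f x y) y x.
Proof.
by move=> fc e /fc[d d0 H]; exists d => // y' x' Y X; exact: H.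
Qed.

(** Compactness of the segment makes the modulus of continuity in [x] uniform in [y]. Both values
    are compared with [g x] at the centre of a covering box, hence [e / 2]. *)
Lemma jcont_tube g x c d : (forall y, jcont g x y) ->
  forall e, 0 < e -> exists2 t : R, 0 < t & forall x' y, `|x' - x| <= t ->
  c <= y <= d -> `|g x' y - g x y| <= e.
Proof.
move=> gc e e0.
have e20 : 0 < e / 2 by rewrite divr_gt0.
have := @segment_compact R c d; rewrite compact_near_coveringP.
move=> /(_ R (nbhs x) (fun x' y => `|g x' y - g x y| <= e) _)[].
  move=> y _; have [t t0 H] := gc y _ e20.
  near=> y' x'; rewrite /=.
  have Y : `|y' - y| <= t.
    near: y'; exists t => //= z; rewrite /ball/= distrC; exact: ltW.
  have X : `|x' - x| <= t.
    near: x'; exists t => //= z; rewrite /ball/= distrC; exact: ltW.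
  have h1 := H _ _ X Y; have := H x y'; rewrite subrr normr0 (ltW t0).
  move=> /(_ isT Y) h2.
  rewrite -(subrKA (g x y)) (le_trans (ler_normD _ _))//.
  by rewrite (splitr e) lerD// distrC.
move=> t /= t0 H; exists (t / 2); first by rewrite divr_gt0.
move=> x' y xt ycd; apply: (H x' _ y) => /=; last by rewrite in_itv.
by rewrite /ball/= distrC (le_lt_trans xt)// ltr_pdivrMr// ltr_pMr// ltr1n.
Unshelve. all: by end_near. Qed.

Lemma itg_param_cont g lo hi c d : c <= d ->
  (forall x y, lo < x < hi -> jcont g x y) ->
  forall x, lo < x < hi -> {for x, continuous (fun x => itg (g x) c d)}.
Proof.
move=> cd gc x xlh; apply: dist_continuous => e e0.
(* The summand 1 keeps the divisor positive when [c = d]. *)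
have K0 : 0 < 1 + (d - c) by rewrite ltr_pwDl// subr_ge0.
have [t t0 H] := jcont_tube c d (fun y => gc x y xlh) (divr_gt0 e0 K0).
have gcx z : lo < z < hi -> cont_on (g z) c d.
  by move=> zlh y _; apply: jcont_cont; exact: gc.
case/andP: xlh => lx xh.
exists (Num.min t (Num.min ((x - lo) / 2) ((hi - x) / 2))).
  by rewrite !lt_min t0 !divr_gt0// subr_gt0.
move=> x'; rewrite !le_min => /and3P[xt xl xr].
have xlh' : lo < x' < hi by move: xl xr; rewrite !ler_distl => ? ?; lra.
rewrite -itgB//; try by apply: gcx => //; apply/andP.
rewrite -[X in `|X|]subr0 -[X in _ - X](mul0r (d - c)).
apply: le_trans (itg_near_cst (e := e / (1 + (d - c))) cd _ _) _.
- by apply: cont_onB; apply: gcx => //; apply/andP.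
- by move=> y ycd; rewrite subr0; apply: H.
- by rewrite -mulrA ler_piMr ?ltW// mulrC ltr_pdivrMr// mul1r; lra.
Qed.

End green.

(** * Nested bisection of rectangles *)

Section bisection.
Variables (R : realType) (a c h k : R) (V : nat -> R -> R -> R).
Hypotheses (h0 : 0 <= h) (k0 : 0 <= k).

Let hn n : R := h / 2 ^+ n.
Let kn n : R := k / 2 ^+ n.
Let inr n (x y : R) :=
  [&& a <= x, x + hn n <= a + h, c <= y & y + kn n <= c + k].

Hypothesis Vsplit : forall n x y, inr n x y ->
  V n x y = V n.+1 x y + V n.+1 (x + hn n.+1) y +
            V n.+1 x (y + kn n.+1) + V n.+1 (x + hn n.+1) (y + kn n.+1).
Hypothesis Vsmall : forall X Y : R, a <= X <= a + h -> c <= Y <= c + k ->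
  forall e : R, 0 < e -> exists n, forall x y, inr n x y ->
  x <= X <= x + hn n -> y <= Y <= y + kn n -> `|V n x y| <= e / 4 ^+ n.

Let halfS (u : R) n : u / 2 ^+ n = u / 2 ^+ n.+1 + u / 2 ^+ n.+1.
Proof. by rewrite exprS; field; rewrite expf_neq0// pnatr_eq0. Qed.

(** If the value were nonzero, one quarter of each rectangle would keep at least a quarter of its
    absolute value. The chosen quarters shrink to a point, where [Vsmall] with half the initial
    absolute value is contradictory. *)
Lemma bisection_eq0 : V 0%N a c = 0.
Proof.
have hn0 n : 0 <= hn n by rewrite /hn divr_ge0// exprn_ge0.
have kn0 n : 0 <= kn n by rewrite /kn divr_ge0// exprn_ge0.
have hS n : hn n = hn n.+1 + hn n.+1 := halfS h n.
have kS n : kn n = kn n.+1 + kn n.+1 := halfS k n.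
apply/eqP/negPn/negP => V0.
pose eta : R := `|V 0%N a c|.
have eta0 : 0 < eta by rewrite normr_gt0.
pose good n (p : R * R) := inr n p.1 p.2 /\ eta / 4 ^+ n <= `|V n p.1 p.2|.
pose adj n (p q : R * R) :=
  [&& p.1 <= q.1, q.1 <= p.1 + hn n.+1, p.2 <= q.2 & q.2 <= p.2 + kn n.+1].
have step (np : nat * (R * R)) : exists q, good np.1 np.2 ->
    good np.1.+1 q /\ adj np.1 np.2 q.
  case: np => n [x y] /=.
  have [gd|ngd] := pselect (good n (x, y)); last by exists (0, 0).
  have [in_n big] := gd; rewrite /= in in_n big.
  have := Vsplit in_n; move: in_n; rewrite /inr => in_n.
  set v1 := V n.+1 _ _; set v2 := V n.+1 _ _.
  set v3 := V n.+1 _ _; set v4 := V n.+1 _ _ => Ve.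
  have := hn0 n.+1; have := kn0 n.+1; have := hS n; have := kS n => kSn hSn k0n h0n.
  have e4 : eta / 4 ^+ n = 4 * (eta / 4 ^+ n.+1).
    by rewrite exprS; field; rewrite expf_neq0// pnatr_eq0.
  (* Pigeonhole: if the sum of four terms has absolute value at least [4 * u], some term has
     absolute value at least [u]. *)
  have lem (P1 : Prop) (u : R) : 4 * u <= `|v1 + v2 + v3 + v4| ->
      (u <= `|v1| -> P1) -> (u <= `|v2| -> P1) -> (u <= `|v3| -> P1) ->
      (u <= `|v4| -> P1) -> P1.
    move=> U q1 q2 q3 q4.
    have [/q1//|l1] := leP u `|v1|; have [/q2//|l2] := leP u `|v2|.
    have [/q3//|l3] := leP u `|v3|; have [/q4//|l4] := leP u `|v4|.
    have := ler_normD (v1 + v2 + v3) v4; have := ler_normD (v1 + v2) v3.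
    by have := ler_normD v1 v2; lra.
  move: big; rewrite Ve e4 => big; apply: (lem _ _ big) => Vi.
  - exists (x, y) => _; rewrite /good /adj /inr/=; split; [split=> //|]; lra.
  - exists (x + hn n.+1, y) => _; rewrite /good /adj /inr/=; split; [split=> //|]; lra.
  - exists (x, y + kn n.+1) => _; rewrite /good /adj /inr/=; split; [split=> //|]; lra.
  - exists (x + hn n.+1, y + kn n.+1) => _; rewrite /good /adj /inr/=; split; [split=> //|]; lra.
have [nxt nxtP] := choice step.
pose z := fix z n := if n is m.+1 then nxt (m, z m) else (a, c).
have zgood n : good n (z n).
  elim: n => [|n /(nxtP (n, z n))[]//]; split => /=.
    by rewrite /inr /hn /kn expr0 !divr1 !lexx.
  by rewrite expr0 divr1.
have zadj n : adj n (z n) (z n.+1) by have [_] := nxtP (n, z n) (zgood n).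
(* Both end points of the nested intervals are monotone, so the left ones are
   bounded by the right ones. *)
have mono m n : [&& (z n).1 <= (z (n + m)%N).1,
    (z (n + m)%N).1 + hn (n + m)%N <= (z n).1 + hn n,
    (z n).2 <= (z (n + m)%N).2 &
    (z (n + m)%N).2 + kn (n + m)%N <= (z n).2 + kn n].
  elim: m => [|m IH]; first by rewrite addn0 !lexx.
  have := zadj (n + m)%N; rewrite /adj addnS.
  have := hS (n + m)%N; have := kS (n + m)%N; lra.
have cmp m n : ((z m).1 <= (z n).1 + hn n) && ((z m).2 <= (z n).2 + kn n).
  have [mn|/ltnW nm] := leqP m n.
    have := mono (n - m)%N m; rewrite subnKC//.
    have := hn0 n; have := kn0 n; lra.
  have := mono (m - n)%N n; rewrite subnKC//.
  have := hn0 m; have := kn0 m; lra.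
(* The common point of the nested rectangles. *)
pose X := sup (range (fst \o z)); pose Y := sup (range (snd \o z)).
have Xn n : (z n).1 <= X <= (z n).1 + hn n.
  apply/andP; split.
    apply: ub_le_sup; last by exists n.
    by exists ((z 0%N).1 + hn 0) => _ [m _ <-]; have /andP[] := cmp m 0%N.
  apply: ge_sup; first by exists (z 0%N).1, 0%N.
  by move=> _ [m _ <-]; have /andP[] := cmp m n.
have Yn n : (z n).2 <= Y <= (z n).2 + kn n.
  apply/andP; split.
    apply: ub_le_sup; last by exists n.
    by exists ((z 0%N).2 + kn 0) => _ [m _ <-]; have /andP[] := cmp m 0%N.
  apply: ge_sup; first by exists (z 0%N).2, 0%N.
  by move=> _ [m _ <-]; have /andP[] := cmp m n.
have e20 : 0 < eta / 2 by rewrite divr_gt0.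
have := Xn 0%N; have := Yn 0%N; rewrite /hn /kn expr0 !divr1 => Y0 X0.
have [n /(_ (z n).1 (z n).2 (zgood n).1 (Xn n) (Yn n))] := Vsmall X0 Y0 e20.
apply/negP; rewrite -ltNge; apply: lt_le_trans (zgood n).2.
by rewrite ltr_pM2r ?invr_gt0 ?exprn_gt0// ltr_pdivrMr// ltr_pMr// ltr1n.
Qed.

End bisection.

(** Additivity under vertical and horizontal cuts gives the splitting into quarters. An error
    quadratic in the side lengths is of order [1 / 4 ^+ n] on dyadic rectangles, as the bisection
    requires. *)
Lemma additive_rectangle_eq0 (R : realType) (lo hi : R) (W : R -> R -> R -> R -> R) :
  (forall x x' x'' y y' : R, lo < x -> x <= x' -> x' <= x'' -> x'' < hi -> y <= y' ->
    W x x'' y y' = W x x' y y' + W x' x'' y y') ->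
  (forall x x' y y' y'' : R, lo < x -> x <= x' -> x' < hi -> y <= y' -> y' <= y'' ->
    W x x' y y'' = W x x' y y' + W x x' y' y'') ->
  (forall X Y : R, lo < X < hi -> forall e : R, 0 < e ->
    exists2 d : R, 0 < d & forall x x' y y' : R, lo < x -> x' < hi ->
    x <= X <= x' -> y <= Y <= y' -> x' - x <= d -> y' - y <= d ->
    `|W x x' y y'| <= 5 * e * ((x' - x) + (y' - y)) ^+ 2) ->
  forall a b c d : R, lo < a -> a <= b -> b < hi -> c <= d -> W a b c d = 0.
Proof.
move=> Wsplit1 Wsplit2 Wsmall a b c d la ab bh cd; pose h := b - a; pose k := d - c.
pose V n x y := W x (x + h / 2 ^+ n) y (y + k / 2 ^+ n).
have h0 : 0 <= h by rewrite subr_ge0.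
have k0 : 0 <= k by rewrite subr_ge0.
have hn0 n : 0 <= h / 2 ^+ n by rewrite divr_ge0// exprn_ge0.
have kn0 n : 0 <= k / 2 ^+ n by rewrite divr_ge0// exprn_ge0.
have halfS (u : R) n : u / 2 ^+ n = u / 2 ^+ n.+1 + u / 2 ^+ n.+1.
  by rewrite exprS; field; rewrite expf_neq0// pnatr_eq0.
have bE : a + h = b by rewrite /h addrC subrK.
have dE : c + k = d by rewrite /k addrC subrK.
clearbody h k.
suff : V 0%N a c = 0 by rewrite /V expr0 !divr1 bE dE.
apply: (@bisection_eq0 _ _ _ h k) => // [n x y|X Y].
  rewrite bE dE => /and4P[ax xb cy yd]; rewrite /V.
  have := hn0 n.+1; have := kn0 n.+1; have := halfS h n; have := halfS k n.
  move: (h / 2 ^+ n) (h / 2 ^+ n.+1) (k / 2 ^+ n) (k / 2 ^+ n.+1) xb yd.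
  move=> u u' v v' xb yd E1 E2 v0 u0; rewrite E1 E2 (addrA x) (addrA y) in xb yd *.
  rewrite (@Wsplit1 x (x + u') (x + u' + u'))//; try lra.
  by rewrite !(@Wsplit2 _ _ y (y + v') (y + v' + v'))//; try lra; ring.
rewrite bE dE => Xab Ycd e e0.
have XX : lo < X < hi by lra.
(* Dividing [e] by this absorbs the factor 5 and the square of [h + k]; the 1 covers a degenerate
   rectangle. *)
have s0 : 0 < 5 * (1 + (h + k) ^+ 2) by rewrite mulr_gt0// ltr_pwDl// sqr_ge0.
have [dl dl0 H] := Wsmall X Y XX _ (divr_gt0 e0 s0).
have [n nP] : exists n, (h + k) / 2 ^+ n <= dl.
  have hk0 : 0 <= (h + k) / dl := divr_ge0 (addr_ge0 h0 k0) (ltW dl0).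
  exists (Num.truncn ((h + k) / dl)).+1.
  rewrite ler_pdivrMr ?exprn_gt0// mulrC -ler_pdivrMr//.
  apply: le_trans (ltW (truncnS_gt _)) _.
  by rewrite -natrX ler_nat ltnW// ltn_expl.
exists n => x y => /and4P[ax xb cy yd] xX yY.
have hkn : h / 2 ^+ n + k / 2 ^+ n = (h + k) / 2 ^+ n by rewrite mulrDl.
have := hn0 n; have := kn0 n => kn hn.
apply: le_trans (H _ _ _ _ _ _ xX yY _ _) _; try lra.
rewrite !(addrC _ (_ / 2 ^+ n)) !addrK hkn expr_div_n -exprM mulnC exprM.
have -> : (2 : R) ^+ 2 = 4 by ring.
rewrite mulrA ler_pM2r ?invr_gt0 ?exprn_gt0//.
set q := (h + k) ^+ 2; have q0 : 0 <= q by exact: sqr_ge0.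
have -> : 5 * (e / (5 * (1 + q))) * q = e * (q / (1 + q)).
  by field; rewrite gt_eqF// ltr_pwDl.
by rewrite ler_piMr ?ltW// ltr_pdivrMr ?ltr_pwDl// mul1r ltrDr.
Qed.

(** * Goursat's argument on a vertical strip *)

Section green_identity.
Variables (R : realType) (lo hi : R) (P Q g : R -> R -> R).
Hypothesis PQ : forall x y : R, lo < x < hi -> exists A B A' B' : R,
  [/\ diff2 P x y A B, diff2 Q x y A' B', jcont g x y & A' - B = g x y].

Let Pc x y : lo < x < hi -> jcont P x y.
Proof. by move=> /(PQ y)[A [B [A' [B' []]]]] /diff2_jcont. Qed.
Let Qc x y : lo < x < hi -> jcont Q x y.
Proof. by move=> /(PQ y)[A [B [A' [B' []]]]] _ /diff2_jcont. Qed.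
Let gc x y : lo < x < hi -> jcont g x y.
Proof. by move=> /(PQ y)[A [B [A' [B' []]]]]. Qed.

(** The defect in Green's identity on a rectangle, to be shown to vanish. *)
Let W x x' y y' : R := itg (fun t => Q x' t - Q x t) y y' -
  itg (fun s => P s y' - P s y) x x' - itg (fun s => itg (g s) y y') x x'.

Let Qcon x y y' : lo < x < hi -> cont_on (Q x) y y'.
Proof. by move=> xlh t _; apply: jcont_cont; exact: Qc. Qed.

Let gcon x y y' : lo < x < hi -> cont_on (g x) y y'.
Proof. by move=> xlh t _; apply: jcont_cont; exact: gc. Qed.

Let Pcon x x' y : lo < x -> x' < hi -> cont_on (fun s => P s y) x x'.
Proof.
move=> lx xh t /andP[xt tx].
apply: (@jcont_cont _ (fun y x => P x y)); apply: jcontC; apply: Pc.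
by rewrite (lt_le_trans lx)//= (le_lt_trans tx).
Qed.

Let igcon x x' y y' : y <= y' -> lo < x -> x' < hi ->
  cont_on (fun s => itg (g s) y y') x x'.
Proof.
move=> yy lx xh t /andP[xt tx]; apply: (itg_param_cont yy gc).
by rewrite (lt_le_trans lx)//= (le_lt_trans tx).
Qed.

Let Wsplit1 (x x' x'' y y' : R) : lo < x -> x <= x' -> x' <= x'' -> x'' < hi ->
  y <= y' -> W x x'' y y' = W x x' y y' + W x' x'' y y'.
Proof.
move=> lx xx xx' xh yy; rewrite /W.
have Px : cont_on (fun s => P s y' - P s y) x x'' by apply: cont_onB; exact: Pcon.
have gx : cont_on (fun s => itg (g s) y y') x x'' by exact: igcon.
rewrite (itg_split Px xx xx') (itg_split gx xx xx').
have h1 : lo < x < hi by lra.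
have h2 : lo < x' < hi by lra.
have h3 : lo < x'' < hi by lra.
have QB u v : lo < u < hi -> lo < v < hi ->
    itg (fun t => Q v t - Q u t) y y' = itg (Q v) y y' - itg (Q u) y y'.
  by move=> uh vh; apply: itgB; exact: Qcon.
by rewrite !QB//; ring.
Qed.

Let Wsplit2 (x x' y y' y'' : R) : lo < x -> x <= x' -> x' < hi -> y <= y' ->
  y' <= y'' -> W x x' y y'' = W x x' y y' + W x x' y' y''.
Proof.
move=> lx xx xh yy yy'; rewrite /W.
have h1 : lo < x < hi by lra.
have h2 : lo < x' < hi by lra.
rewrite (@itg_split _ (fun t => Q x' t - Q x t) y y'' y')//; last first.
  by apply: cont_onB; exact: Qcon.
have y3 : y <= y'' by lra.
have -> : itg (fun s => itg (g s) y' y'') x x' =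
    itg (fun s => itg (g s) y y'' - itg (g s) y y') x x'.
  apply: eq_itg => s sx; rewrite (@itg_split _ (g s) y y'' y')//; last first.
    by apply: gcon; lra.
  by rewrite addrAC subrr add0r.
have PB u v : itg (fun s => P s v - P s u) x x' =
    itg (fun s => P s v) x x' - itg (fun s => P s u) x x'.
  by apply: itgB; exact: Pcon.
have -> : itg (fun s => itg (g s) y y'' - itg (g s) y y') x x' =
    itg (fun s => itg (g s) y y'') x x' - itg (fun s => itg (g s) y y') x x'.
  by apply: itgB; exact: igcon.
by rewrite !PB; ring.
Qed.

(** Near [(X, Y)] the forms are replaced by their affine parts and [g] by its value. The main terms
    cancel because [A' - B = g X Y], and only the three replacement errors remain. *)
Let Wsmall (X Y : R) : lo < X < hi -> forall e : R, 0 < e ->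
  exists2 d : R, 0 < d & forall x x' y y' : R, lo < x -> x' < hi -> x <= X <= x' ->
    y <= Y <= y' -> x' - x <= d -> y' - y <= d ->
  `|W x x' y y'| <= 5 * e * ((x' - x) + (y' - y)) ^+ 2.
Proof.
move=> XX e e0; have [A [B [A' [B' [dP dQ cg E]]]]] := PQ Y XX.
have [d1 d10 H1] := dP _ e0; have [d2 d20 H2] := dQ _ e0.
have [d3 d30 H3] := cg _ e0.
exists (Num.min d1 (Num.min d2 d3)); first by rewrite !lt_min d10 d20.
move=> x x' y y' lx xh xX yY; rewrite !le_min => /and3P[x1 x2 x3] /and3P[y1 y2 y3].
have dx s : x <= s <= x' -> `|s - X| <= x' - x by rewrite ler_norml; lra.
have dy t : y <= t <= y' -> `|t - Y| <= y' - y by rewrite ler_norml; lra.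
set h := x' - x; set k := y' - y.
have h0 : 0 <= h by rewrite /h; lra.
have k0 : 0 <= k by rewrite /k; lra.
have xx : x <= x' by lra.
have yy : y <= y' by lra.
have x1X : x <= x <= x' by lra.
have x2X : x <= x' <= x' by lra.
have y1Y : y <= y <= y' by lra.
have y2Y : y <= y' <= y' by lra.
have lxh s : x <= s <= x' -> lo < s < hi by lra.
have bQ : `|itg (fun t => Q x' t - Q x t) y y' - (A' * h) * k| <= (2 * e * (h + k)) * k.
  apply: itg_near_cst => //.
    by apply: cont_onB; apply: Qcon; exact: lxh.
  move=> t ty.
  have := H2 _ _ (le_trans (dx _ x1X) x2) (le_trans (dy _ ty) y2).
  have := H2 _ _ (le_trans (dx _ x2X) x2) (le_trans (dy _ ty) y2).
  have : e * (`|x' - X| + `|t - Y|) <= e * (h + k).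
    by rewrite ler_pM2l// lerD ?dx ?dy.
  have : e * (`|x - X| + `|t - Y|) <= e * (h + k).
    by rewrite ler_pM2l// lerD ?dx ?dy.
  move: (e * (`|x' - _| + _)) (e * (`|x - _| + _)) => u v.
  have -> : 2 * e * (h + k) = e * (h + k) + e * (h + k) by ring.
  have -> : A' * h = A' * (x' - X) - A' * (x - X) by rewrite /h; ring.
  by rewrite !ler_norml; lra.
have bP : `|itg (fun s => P s y' - P s y) x x' - (B * k) * h| <= (2 * e * (h + k)) * h.
  apply: itg_near_cst => //; first by apply: cont_onB; exact: Pcon.
  move=> s sx.
  have := H1 _ _ (le_trans (dx _ sx) x1) (le_trans (dy _ y1Y) y1).
  have := H1 _ _ (le_trans (dx _ sx) x1) (le_trans (dy _ y2Y) y1).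
  have : e * (`|s - X| + `|y - Y|) <= e * (h + k).
    by rewrite ler_pM2l// lerD ?dx ?dy.
  have : e * (`|s - X| + `|y' - Y|) <= e * (h + k).
    by rewrite ler_pM2l// lerD ?dx ?dy.
  move: (e * (_ + `|y' - _|)) (e * (_ + `|y - _|)) => u v.
  have -> : 2 * e * (h + k) = e * (h + k) + e * (h + k) by ring.
  have -> : B * k = B * (y' - Y) - B * (y - Y) by rewrite /k; ring.
  by rewrite !ler_norml; lra.
have bg : `|itg (fun s => itg (g s) y y') x x' - (g X Y * k) * h| <= (e * k) * h.
  apply: itg_near_cst => //; first exact: igcon.
  move=> s sx; apply: itg_near_cst => //; first by apply: gcon; exact: lxh.
  move=> t ty; apply: H3; first exact: le_trans (dx _ sx) x3.
  exact: le_trans (dy _ ty) y3.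
have key : A' * h * k = B * k * h + g X Y * k * h by rewrite -E; ring.
(* The first three summands are the error bounds for [Q], [P] and [g]; the last one is a nonnegative
   surplus. *)
have sq : 5 * e * (h + k) ^+ 2 = 2 * e * (h + k) * k + 2 * e * (h + k) * h +
    e * k * h + e * (3 * h ^+ 2 + 3 * k ^+ 2 + 5 * (h * k)) by ring.
have nn : 0 <= e * (3 * h ^+ 2 + 3 * k ^+ 2 + 5 * (h * k)).
  by rewrite mulr_ge0 ?(ltW e0)// !addr_ge0 ?mulr_ge0 ?sqr_ge0.
move: bQ bP bg key sq nn; rewrite !ler_norml /W.
move: (itg _ _ _) (itg _ _ _) (itg _ _ _) => I1 I2 I3.
by move: (5 * e * _) => S; lra.
Qed.

(* [g] is the curl of the form [P dx + Q dy]; no continuity of the partial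
   derivatives is assumed, whence the subdivision argument of Goursat. *)
Lemma green_rectangle a b c d : lo < a -> a <= b -> b < hi -> c <= d ->
  itg (fun t => Q b t - Q a t) c d =
  itg (fun s => P s d - P s c) a b + itg (fun s => itg (g s) c d) a b.
Proof.
move=> la ab bh cd.
have := additive_rectangle_eq0 (@Wsplit1) (@Wsplit2) (@Wsmall) la ab bh cd.
by rewrite /W => /eqP; rewrite subr_eq0 subr_eq => /eqP ->; rewrite addrC.
Qed.

End green_identity.

(** * Differentiability in two real variables and the Cauchy-Riemann equations *)

Section diff2_calculus.
Variable R : realType.
Implicit Types (f p q : R -> R -> R) (x y A B e : R) (u : R -> R).

Lemma diff2_cst k x y : diff2 (fun _ _ => k) x y 0 0.
Proof.
move=> e e0; exists 1 => // x' y' _ _.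
by rewrite !mul0r !subr0 subrr normr0 mulr_ge0 ?addr_ge0// ltW.
Qed.

Lemma diff2_derive1 u x y A : is_derive x 1 u A -> diff2 (fun x _ => u x) x y A 0.
Proof.
move=> ud e e0; have du : derivable u x 1 by case: ud.
have uA : 'D_1 u x = A by apply: derive_val.
move: du; rewrite /derivable => /cvg_ex[l lP].
have lA : l = A by rewrite -uA /derive; apply/esym/cvg_lim.
move: lP; rewrite {}lA => /cvgrPdist_le /(_ _ e0) [d /= d0 H].
exists (d / 2); first by rewrite divr_gt0.
move=> x' y' xd _; rewrite mul0r subr0.
have [->|xx] := eqVneq x' x.
  by rewrite !subrr mulr0 subr0 normr0 mulr_ge0 ?addr_ge0// ltW.
have x0 : x' - x != 0 by rewrite subr_eq0.
have := H (x' - x); rewrite /ball/= sub0r normrN.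
move=> /(_ _ x0); rewrite (le_lt_trans xd); last first.
  by rewrite ltr_pdivrMr// ltr_pMr// ltr1n.
move=> /(_ isT); rewrite /= [_ *: 1]mulr1 subrK => {}H.
have -> : u x' - u x - A * (x' - x) =
    - ((x' - x) * (A - (x' - x)^-1 *: (u x' - u x))).
  by rewrite /GRing.scale/=; field.
rewrite normrN normrM mulrC; apply: le_trans (_ : e * `|x' - x| <= _).
  by rewrite ler_wpM2r.
by rewrite ler_wpM2l ?(ltW e0)// lerDl.
Qed.

Lemma diff2C f x y A B : diff2 f x y A B -> diff2 (fun y x => f x y) y x B A.
Proof.
move=> fd e /fd[d d0 H]; exists d => // y' x' yd xd.
by rewrite addrAC [X in _ <= _ * X]addrC; exact: H.
Qed.

Lemma diff2_derive2 u x y A : is_derive y 1 u A -> diff2 (fun _ y => u y) x y 0 A.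
Proof. by move=> ud; apply: (@diff2C (fun x _ => u x)); exact: diff2_derive1. Qed.

Lemma diff2_lipschitz f x y A B : diff2 f x y A B -> exists2 d : R, 0 < d &
  forall x' y', `|x' - x| <= d -> `|y' - y| <= d ->
  `|f x' y' - f x y| <= (1 + `|A| + `|B|) * (`|x' - x| + `|y' - y|).
Proof.
move=> fd; have [d d0 H] := fd 1 ltr01; exists d => // x' y' xd yd.
have := H _ _ xd yd; rewrite mul1r.
have := normrM A (x' - x); have := normrM B (y' - y).
move: (A * _) (B * _) => a b nb na {}H.
rewrite (_ : f x' y' - f x y = f x' y' - f x y - a - b + a + b); last by ring.
rewrite (le_trans (ler_normD _ _))// nb.
rewrite (le_trans (lerD (ler_normD _ _) (lexx _)))// na.
have h1 : 0 <= `|A| * `|y' - y| by rewrite mulr_ge0.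
have h2 : 0 <= `|B| * `|x' - x| by rewrite mulr_ge0.
by rewrite !mulrDl !mulrDr !mul1r; lra.
Qed.

(** Chain rule. One third of [e] goes to the expansion of [f] and one third to each inner function;
    the radii [d1 / (2 * Kp)] and [d1 / (2 * Kq)] keep the inner increments within [d1]. *)
Lemma diff2_comp f p q x y A B (p1 p2 q1 q2 : R) :
  diff2 f (p x y) (q x y) A B -> diff2 p x y p1 p2 -> diff2 q x y q1 q2 ->
  diff2 (fun x y => f (p x y) (q x y)) x y (A * p1 + B * q1) (A * p2 + B * q2).
Proof.
move=> fd pd qd e e0.
have [dp dp0 Lp] := diff2_lipschitz pd; have [dq dq0 Lq] := diff2_lipschitz qd.
pose Kp : R := 1 + `|p1| + `|p2|; pose Kq : R := 1 + `|q1| + `|q2|.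
have Kp0 : 0 < Kp by rewrite /Kp -addrA ltr_pwDl.
have Kq0 : 0 < Kq by rewrite /Kq -addrA ltr_pwDl.
have e30 : 0 < e / 3 by rewrite divr_gt0.
have [d1 d10 H1] := fd _ (divr_gt0 e30 (addr_gt0 Kp0 Kq0)).
have A0 : 0 < 1 + `|A| by rewrite ltr_pwDl.
have B0 : 0 < 1 + `|B| by rewrite ltr_pwDl.
have [d2 d20 H2] := pd _ (divr_gt0 e30 A0).
have [d3 d30 H3] := qd _ (divr_gt0 e30 B0).
have d40 : 0 < d1 / (2 * Kp) by rewrite divr_gt0// mulr_gt0.
have d50 : 0 < d1 / (2 * Kq) by rewrite divr_gt0// mulr_gt0.
exists (\big[Num.min/dp]_(d <- [:: dq; d2; d3; d1 / (2 * Kp); d1 / (2 * Kq)]) d).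
  by rewrite !big_cons big_nil !lt_min dp0 dq0 d20 d30 d40 d50.
move=> x' y'; rewrite !big_cons big_nil !le_min.
move=> /and5P[xq x2 x3 x4 /andP[x5 xp]] /and5P[yq y2 y3 y4 /andP[y5 yp]].
set N := `|x' - x| + `|y' - y|.
have N0 : 0 <= N by rewrite addr_ge0.
have lp : `|p x' y' - p x y| <= Kp * N by exact: Lp.
have lq : `|q x' y' - q x y| <= Kq * N by exact: Lq.
have lp1 : `|p x' y' - p x y| <= d1.
  apply: le_trans lp _; rewrite mulrC -ler_pdivlMr//.
  have -> : d1 / Kp = d1 / (2 * Kp) + d1 / (2 * Kp) by field; rewrite gt_eqF.
  exact: lerD.
have lq1 : `|q x' y' - q x y| <= d1.
  apply: le_trans lq _; rewrite mulrC -ler_pdivlMr//.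
  have -> : d1 / Kq = d1 / (2 * Kq) + d1 / (2 * Kq) by field; rewrite gt_eqF.
  exact: lerD.
have a1 : `|f (p x' y') (q x' y') - f (p x y) (q x y) - A * (p x' y' - p x y) -
    B * (q x' y' - q x y)| <= e / 3 * N.
  apply: le_trans (H1 _ _ lp1 lq1) _.
  have Kpq : 0 < Kp + Kq by exact: addr_gt0.
  have -> : e / 3 * N = e / 3 / (Kp + Kq) * ((Kp + Kq) * N).
    by rewrite mulrA divfK// gt_eqF.
  by rewrite ler_wpM2l ?(ltW (divr_gt0 e30 Kpq))// mulrDl lerD.
have aux (C Z : R) : 0 < 1 + `|C| -> `|Z| <= e / 3 / (1 + `|C|) * N ->
    `|C * Z| <= e / 3 * N.
  move=> C0 ZN; rewrite normrM.
  apply: le_trans (ler_wpM2l (normr_ge0 C) ZN) _.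
  rewrite mulrA ler_wpM2r// mulrCA ler_piMr ?ltW//.
  by rewrite ltr_pdivrMr// mul1r ltrDr.
have a2 := aux A _ A0 (H2 _ _ x2 y2).
have a3 := aux B _ B0 (H3 _ _ x3 y3).
have -> : e * N = e / 3 * N + e / 3 * N + e / 3 * N by field.
rewrite [X in `|X|](_ : _ = f (p x' y') (q x' y') - f (p x y) (q x y) -
  A * (p x' y' - p x y) - B * (q x' y' - q x y) +
  A * (p x' y' - p x y - p1 * (x' - x) - p2 * (y' - y)) +
  B * (q x' y' - q x y - q1 * (x' - x) - q2 * (y' - y))); last by ring.
rewrite (le_trans (ler_normD _ _))// lerD//.
by rewrite (le_trans (ler_normD _ _))// lerD.
Qed.

Lemma diff2_add x y : diff2 (fun x y => x + y) x y 1 1.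
Proof.
move=> e e0; exists 1 => // x' y' _ _.
have -> : x' + y' - (x + y) - 1 * (x' - x) - 1 * (y' - y) = 0 by ring.
by rewrite normr0 mulr_ge0 ?addr_ge0// ltW.
Qed.

Lemma diff2_mul x y : diff2 (fun x y => x * y) x y y x.
Proof.
move=> e e0; exists e => // x' y' xe ye.
have -> : x' * y' - x * y - y * (x' - x) - x * (y' - y) =
  (x' - x) * (y' - y) by ring.
rewrite normrM; apply: le_trans (_ : e * `|y' - y| <= _).
  by rewrite ler_wpM2r.
by rewrite ler_wpM2l ?(ltW e0)// lerDr.
Qed.

Lemma diff2D f p x y A B A' B' : diff2 f x y A B -> diff2 p x y A' B' ->
  diff2 (fun x y => f x y + p x y) x y (A + A') (B + B').
Proof.
move=> fd pd; have := diff2_comp (diff2_add (f x y) (p x y)) fd pd.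
by rewrite !mul1r.
Qed.

Lemma diff2M f p x y A B A' B' : diff2 f x y A B -> diff2 p x y A' B' ->
  diff2 (fun x y => f x y * p x y) x y (p x y * A + f x y * A')
    (p x y * B + f x y * B').
Proof. by move=> fd pd; exact: diff2_comp (diff2_mul (f x y) (p x y)) fd pd. Qed.

End diff2_calculus.

Section cauchy_riemann.
Variable R : realType.
Implicit Types (F : R[i]^o -> R[i]^o) (z : R[i]).

Lemma cabs_ge0 z : 0 <= cabs z.
Proof. by case: z => x y; exact: sqrtr_ge0. Qed.

Lemma normc_le_ReIm z : cabs z <= `|complex.Re z| + `|complex.Im z|.
Proof.
case: z => x y; rewrite /ComplexField.Normc.normc /=.
rewrite -(@ler_pXn2r _ 2)// ?nnegrE ?sqrtr_ge0 ?addr_ge0//.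
rewrite sqr_sqrtr ?addr_ge0 ?sqr_ge0// sqrrD !real_normK ?num_real//.
by rewrite addrAC lerDl mulrn_wge0// mulr_ge0.
Qed.

Lemma Re_le_normc z : `|complex.Re z| <= cabs z.
Proof.
case: z => x y; rewrite /ComplexField.Normc.normc /= -sqrtr_sqr.
by rewrite ler_wsqrtr// lerDl sqr_ge0.
Qed.

Lemma Im_le_normc z : `|complex.Im z| <= cabs z.
Proof.
case: z => x y; rewrite /ComplexField.Normc.normc /= -sqrtr_sqr.
by rewrite ler_wsqrtr// lerDr sqr_ge0.
Qed.

Lemma normE_cabs (z : R[i]) : `|z| = (cabs z)%:C.
Proof. by rewrite normc_def; case: z. Qed.

Lemma derivable_first_order F z : derivable F z 1 -> exists L : R[i],
  forall e : R, 0 < e -> exists2 d : R, 0 < d & forall h : R[i], cabs h <= d ->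
  cabs (F (z + h) - F z - L * h) <= e * cabs h.
Proof.
rewrite /derivable => /cvg_ex[L LP]; exists L => e e0.
have ec : 0 < (e%:C : R[i]) by rewrite ltcR.
move: LP => /cvgrPdist_le /(_ _ ec) [d /= d0 H].
(* The radius supplied by the topology of [R[i]] is a complex number; being positive, it is real. *)
have [dI dR] : complex.Im d = 0 /\ 0 < complex.Re d.
  by move: d0; rewrite ltcE/= => /andP[/eqP].
have dE : d = (complex.Re d)%:C by case: (d) dI => a b /= ->.
exists (complex.Re d / 2); first by rewrite divr_gt0.
move=> h hd; have [->|h0] := eqVneq h 0.
  by rewrite addr0 subrr mulr0 subr0 /ComplexField.Normc.normc/= expr0n/= addr0
    sqrtr0 mulr0.
have := H h; rewrite /ball/= sub0r normrN => /(_ _ h0).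
rewrite normE_cabs dE ltcR (le_lt_trans hd); last first.
  by rewrite ltr_pdivrMr// ltr_pMr// ltr1n.
move=> /(_ isT); rewrite /= [_ *: 1]mulr1 normE_cabs lecR => {}H.
have -> : F (z + h) - F z - L * h = - (h * (L - h^-1 *: (F (h + z) - F z))).
  by rewrite /GRing.scale/= (addrC h z); field.
rewrite normcN ComplexField.Normc.normcM mulrC.
exact: ler_wpM2r (cabs_ge0 h) _ _ H.
Qed.

(** The complex derivative [al + i be] acts on an increment by multiplication; the real and
    imaginary parts of the product are the two differentials. *)
Lemma derivable_cauchy_riemann F (x y : R) : derivable F (x +i* y) 1 ->
  exists al be : R,
  diff2 (fun x y => complex.Re (F (x +i* y))) x y al (- be) /\
  diff2 (fun x y => complex.Im (F (x +i* y))) x y be al.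
Proof.
move=> /derivable_first_order[[al be] H]; exists al, be.
have {}H (e : R) : 0 < e -> exists2 d : R, 0 < d & forall x' y' : R,
    `|x' - x| <= d -> `|y' - y| <= d ->
    cabs (F (x' +i* y') - F (x +i* y) - (al +i* be) * ((x' - x) +i* (y' - y))) <=
    e * (`|x' - x| + `|y' - y|).
  move=> e0; have [d d0 {}H] := H e e0; exists (d / 2); first by rewrite divr_gt0.
  move=> x' y' xd yd.
  have hd : cabs ((x' - x) +i* (y' - y)) <= `|x' - x| + `|y' - y|.
    exact: normc_le_ReIm ((x' - x) +i* (y' - y)).
  have := H ((x' - x) +i* (y' - y)).
  have -> : (x +i* y) + ((x' - x) +i* (y' - y)) = x' +i* y' :> R[i].
    by apply/eqP; rewrite eq_complex/= !(addrC _ (_ - _)) !subrK !eqxx.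
  move=> /(_ (le_trans hd _)) {}H.
  apply: le_trans (H _) _; first by rewrite (splitr d) lerD.
  by rewrite ler_pM2l.
split=> e e0; have [d d0 {}H] := H e e0; exists d => // x' y' xd yd.
- apply: le_trans (H _ _ xd yd); apply: le_trans (Re_le_normc _).
  move: (F (x' +i* y')) (F (x +i* y)) => [a b] [a' b'] /=.
  by rewrite le_eqVlt; apply/orP; left; apply/eqP; congr `|_|; ring.
- apply: le_trans (H _ _ xd yd); apply: le_trans (Im_le_normc _).
  move: (F (x' +i* y')) (F (x +i* y)) => [a b] [a' b'] /=.
  by rewrite le_eqVlt; apply/orP; left; apply/eqP; congr `|_|; ring.
Qed.

End cauchy_riemann.

(** * Taylor coefficients as means over circles, and Cauchy's estimate *)

Section circle_means.
Variables (R : realType) (F : R[i]^o -> R[i]^o) (c0 : R).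
Hypothesis Fhol : forall x y : R, c0 < x -> derivable F (x +i* y) 1.
Implicit Types (x y t r : R) (k : nat).

Let u x y : R := complex.Re (F (x +i* y)).
Let v x y : R := complex.Im (F (x +i* y)).

Definition circle_re r k x t : R :=
  u (x + r * cos t) (r * sin t) * cos (k%:R * t) +
  v (x + r * cos t) (r * sin t) * sin (k%:R * t).

Definition circle_im r k x t : R :=
  v (x + r * cos t) (r * sin t) * cos (k%:R * t) -
  u (x + r * cos t) (r * sin t) * sin (k%:R * t).

(* [2 pi r^k] times the real part of the k-th Taylor coefficient at [x]. *)
Definition circle_coef r k x : R := itg (circle_re r k x) 0 (pi *+ 2).

Let pi20 : 0 <= (pi *+ 2 : R).
Proof. by rewrite mulrn_wge0// pi_ge0. Qed.

Let cosk k : cos (k%:R * (pi *+ 2) : R) = 1 /\ sin (k%:R * (pi *+ 2) : R) = 0.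
Proof.
elim: k => [|k [ck sk]]; first by rewrite mul0r cos0 sin0.
rewrite -natr1 mulrDl mul1r (cosD (k%:R * _)) (sinD (k%:R * _)) ck sk cos2pi sin2pi; split; ring.
Qed.

(** This makes the sides [t = 0] and [t = 2 pi] cancel in Green's identity. *)
Lemma circle_im_periodic r k x : circle_im r k x (pi *+ 2) = circle_im r k x 0.
Proof.
have [ck sk] := cosk k.
by rewrite /circle_im ck sk cos2pi sin2pi !mulr0 cos0 sin0 !mulr0.
Qed.

Let is_derive_cosk k t :
  is_derive t 1 (fun t => cos (k%:R * t)) (- sin (k%:R * t) * k%:R).
Proof.
apply: (@is_derive1_comp _ cos (fun t => k%:R * t)).
rewrite -[X in is_derive _ _ _ X]mulr1; exact: is_deriveZ.
Qed.

Let is_derive_sink k t :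
  is_derive t 1 (fun t => sin (k%:R * t)) (cos (k%:R * t) * k%:R).
Proof.
apply: (@is_derive1_comp _ sin (fun t => k%:R * t)).
rewrite -[X in is_derive _ _ _ X]mulr1; exact: is_deriveZ.
Qed.

Let is_derive_nsink k t :
  is_derive t 1 (fun t => - sin (k%:R * t)) (- (cos (k%:R * t) * k%:R)).
Proof. exact: is_deriveN. Qed.

Let diff2_shift x t r : c0 < x + r * cos t -> exists al be : R,
  diff2 (fun x t => u (x + r * cos t) (r * sin t)) x t
    al (al * (- (r * sin t)) - be * (r * cos t)) /\
  diff2 (fun x t => v (x + r * cos t) (r * sin t)) x t
    be (be * (- (r * sin t)) + al * (r * cos t)).
Proof.
move=> cx; have [al [be [ud vd]]] := derivable_cauchy_riemann (@Fhol _ (r * sin t) cx).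
exists al, be.
have d1 : diff2 (fun x t => x + r * cos t) x t 1 (- (r * sin t)).
  have h1 : diff2 (fun x _ => x) x t 1 0.
    by apply: (@diff2_derive1 _ id); exact: is_derive_id.
  have h2 : diff2 (fun _ t => r * cos t) x t 0 (- (r * sin t)).
    apply: (@diff2_derive2 _ (fun t => r * cos t)).
    by rewrite -mulrN; exact: is_deriveZ.
  by have := diff2D h1 h2; rewrite addr0 add0r.
have d2 : diff2 (fun _ t => r * sin t) x t 0 (r * cos t).
  by apply: (@diff2_derive2 _ (fun t => r * sin t)); exact: is_deriveZ.
split.
  have := diff2_comp (p := fun x t => x + r * cos t)
    (q := fun _ t => r * sin t) ud d1 d2; rewrite mulr1 mulr0 addr0.
  by rewrite mulNr.
by have := diff2_comp (p := fun x t => x + r * cos t)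
    (q := fun _ t => r * sin t) vd d1 d2; rewrite mulr1 mulr0 addr0.
Qed.

(** The chain rule for the conformal map [s + it] to [x + e^(s + it)], in which the Cauchy-Riemann
    equations persist. *)
Let diff2_dilate x s t : c0 < x + expR s * cos t -> exists al be : R,
  diff2 (fun s t => u (x + expR s * cos t) (expR s * sin t)) s t
    (al * (expR s * cos t) - be * (expR s * sin t))
    (al * (- (expR s * sin t)) - be * (expR s * cos t)) /\
  diff2 (fun s t => v (x + expR s * cos t) (expR s * sin t)) s t
    (be * (expR s * cos t) + al * (expR s * sin t))
    (be * (- (expR s * sin t)) + al * (expR s * cos t)).
Proof.
move=> cx; have [al [be [ud vd]]] := derivable_cauchy_riemann (@Fhol _ (expR s * sin t) cx).
exists al, be.
have de : diff2 (fun s _ => expR s) s t (expR s) 0 by exact: diff2_derive1.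
have dc : diff2 (fun _ t => cos t) s t 0 (- sin t) by exact: diff2_derive2.
have ds : diff2 (fun _ t => sin t) s t 0 (cos t) by exact: diff2_derive2.
have d1 : diff2 (fun s t => x + expR s * cos t) s t (expR s * cos t)
    (- (expR s * sin t)).
  have := diff2D (diff2_cst x s t) (diff2M de dc).
  by rewrite !mulr0 !addr0 !add0r mulrN mulrC.
have d2 : diff2 (fun s t => expR s * sin t) s t (expR s * sin t) (expR s * cos t).
  by have := diff2M de ds; rewrite !mulr0 addr0 add0r mulrC.
split.
  by have := diff2_comp (p := fun s t => x + expR s * cos t)
    (q := fun s t => expR s * sin t) ud d1 d2; rewrite !mulNr.
by have := diff2_comp (p := fun s t => x + expR s * cos t)
    (q := fun s t => expR s * sin t) vd d1 d2.
Qed.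

Let circle_in x r t : 0 <= r -> c0 + r < x -> c0 < x + r * cos t.
Proof.
move=> r0 cx; have : - r <= r * cos t; last by lra.
by rewrite -[leLHS]mulr1 mulNr -mulrN ler_wpM2l// cos_geN1.
Qed.

(** The [x]-partial of the first function is [Re (F' e^(-ikt))], and the [t]-partial of the second
    contains [r] times the same quantity. In the curl this unknown derivative therefore cancels, and
    only a continuous function is left. *)
Let diff2_circle r k x t : 0 <= r -> c0 + r < x -> exists al be : R,
  [/\ diff2 (circle_re r k) x t (al * cos (k%:R * t) + be * sin (k%:R * t))
      ((al * (- (r * sin t)) - be * (r * cos t)) * cos (k%:R * t) +
       (be * (- (r * sin t)) + al * (r * cos t)) * sin (k%:R * t) +
       k%:R * circle_im r k x t) &
    diff2 (circle_im r k.+1) x t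
      (be * cos (k.+1%:R * t) - al * sin (k.+1%:R * t))
      (r * (al * cos (k%:R * t) + be * sin (k%:R * t)) -
       k.+1%:R * circle_re r k.+1 x t)].
Proof.
move=> r0 cx; have [al [be [ud vd]]] := diff2_shift (@circle_in x r t r0 cx).
exists al, be.
have dc n := diff2_derive2 x (is_derive_cosk n t).
have ds n := diff2_derive2 x (is_derive_sink n t).
have dn n := diff2_derive2 x (is_derive_nsink n t).
split.
  have := diff2D (diff2M ud (dc k)) (diff2M vd (ds k)); congr diff2.
    by rewrite !mulr0 !addr0 mulrC; congr (_ + _); rewrite mulrC.
  by rewrite /circle_im; ring.
have := diff2D (diff2M vd (dc k.+1)) (diff2M ud (dn k.+1)).
rewrite (_ : (fun x t => _ + _) = circle_im r k.+1); last first.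
  by apply/funext => x'; apply/funext => t'; rewrite /circle_im mulrN.
congr diff2; first by ring.
rewrite /circle_re; have := cos2Dsin2 t.
rewrite -!natr1 !mulrDl !mul1r cosD sinD.
move: (cos (_ * _)) (sin (_ * _)) (cos t) (sin t) (u _ _) (v _ _) => C S c s U V.
move=> cs; apply/eqP; rewrite -subr_eq0; apply/eqP.
(* After the angle additions, the two sides differ by a multiple of [cos^2 + sin^2 - 1]. *)
transitivity (r * (al * C + be * S) * (c ^+ 2 + s ^+ 2 - 1)); first by ring.
by rewrite cs subrr mulr0.
Qed.

Lemma circle_re_jcont r k x t : 0 <= r -> c0 + r < x -> jcont (circle_re r k) x t.
Proof.
by move=> r0 cx; have [al [be [/diff2_jcont]]] := diff2_circle k t r0 cx.
Qed.

Lemma circle_re_cont r k x : 0 <= r -> c0 + r < x ->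
  cont_on (circle_re r k x) 0 (pi *+ 2).
Proof. by move=> r0 cx t _; apply: jcont_cont; exact: circle_re_jcont. Qed.

Lemma circle_coef_cont r k x : 0 <= r -> c0 + r < x ->
  {for x, continuous (circle_coef r k)}.
Proof.
move=> r0 cx; apply: (itg_param_cont (lo := c0 + r) (hi := x + 1) pi20).
  by move=> x' y /andP[cx' _]; exact: circle_re_jcont.
by rewrite cx ltrDl ltr01.
Qed.

(* Green's identity for [Re (F z e^(-ikt)) dt + Im (F z e^(-i(k+1)t)) / r dx],
   where [z = x + r e^(it)]; its curl is [(k + 1) / r * Re (F z e^(-i(k+1)t))]. *)
Lemma circle_coefB r k a b : 0 < r -> c0 + r < a -> a <= b ->
  circle_coef r k b - circle_coef r k a =
  itg (fun x => k.+1%:R / r * circle_coef r k.+1 x) a b.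
Proof.
move=> r0 ca ab; have r0' := ltW r0.
have := @green_rectangle R (c0 + r) (b + 1) (fun x t => r^-1 * circle_im r k.+1 x t)
  (circle_re r k) (fun x t => k.+1%:R / r * circle_re r k.+1 x t).
move=> /(_ _ a b 0 (pi *+ 2) ca ab _ pi20) GR.
have {}GR : itg (fun t => circle_re r k b t - circle_re r k a t) 0 (pi *+ 2) =
    itg (fun s => itg (fun t => k.+1%:R / r * circle_re r k.+1 s t) 0 (pi *+ 2)) a b.
  rewrite GR ?ltrDl ?ltr01//; last first.
    move=> x y /andP[cx _].
    have [al [be [Qd Pd]]] := diff2_circle k y r0' cx.
    have Cd := diff2_cst r^-1 x y.
    have := diff2M Cd Pd; rewrite !mulr0 !add0r => Pd'.
    do 4 eexists; split; [exact: Pd'|exact: Qd| |].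
      have [al' [be' [Qd' _]]] := diff2_circle k.+1 y r0' cx.
      by have := diff2_jcont (diff2M (diff2_cst (k.+1%:R / r) x y) Qd').
    by field; rewrite gt_eqF.
  rewrite (@eq_itg _ _ (fun=> 0)) ?itg_cst ?mul0r ?add0r//.
  by move=> s _; rewrite circle_im_periodic subrr.
rewrite /circle_coef -itgB; last 2 first.
- by apply: circle_re_cont => //; exact: lt_le_trans ca ab.
- exact: circle_re_cont.
rewrite GR; apply: eq_itg => x /andP[ax xb]; rewrite !itgE RintegralZl//.
by apply: cont_integrable; apply: circle_re_cont => //; exact: lt_le_trans ca ax.
Qed.

(** The fundamental theorem of calculus applied to [circle_coefB], from a base point [a] strictly
    between [c0 + r] and [x]. *)
Lemma is_derive_circle_coef r k x : 0 < r -> c0 + r < x ->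
  is_derive x 1 (circle_coef r k) (k.+1%:R / r * circle_coef r k.+1 x).
Proof.
move=> r0 cx; pose a := (c0 + r + x) / 2.
have ca : c0 + r < a by rewrite /a; lra.
have ax : a < x by rewrite /a; lra.
pose h (y : R) : R := k.+1%:R / r * circle_coef r k.+1 y.
have hc y : c0 + r < y -> {for y, continuous h}.
  by move=> cy; apply: cvgMr; exact: circle_coef_cont (ltW r0) cy.
have hi : (@lebesgue_measure R).-integrable `[a, x + 1] (EFin \o h).
  by apply: cont_integrable => y /andP[ay _]; apply: hc; exact: lt_le_trans ay.
have x1 : x < x + 1 by rewrite ltrDl.
have [hd hE] := continuous_FTC1_closed x1 hi ax (hc _ cx).
rewrite -/(h x).
have D : is_derive x 1 (fun y => circle_coef r k a + itg h a y) (h x).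
  rewrite -[h x]add0r; apply: is_deriveD.
  by split; [exact: hd|rewrite -derive1E].
apply: near_eq_is_derive D.
have : \forall y \near x, a < y by exact: lt_nbhsr.
apply: filterS => y ay.
by rewrite -(circle_coefB k r0 ca (ltW ay)) addrC subrK.
Qed.

(* In the coordinates [(s, t)] with [z = x + e^(s + it)] the form
   [Re (F z) dt + Im (F z) ds] is closed, so the mean over the circle does not
   depend on the radius, which is then sent to 0. *)
Lemma circle_mean r x : 0 < r -> c0 + r < x ->
  circle_coef r 0 x = u x 0 * (pi *+ 2).
Proof.
move=> r0 cx.
pose h s t := u (x + expR s * cos t) (expR s * sin t).
pose w s t := v (x + expR s * cos t) (expR s * sin t).
have x0 : 0 < x - c0 by lra.
have hin s t : s < ln (x - c0) -> c0 < x + expR s * cos t.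
  move=> sx; apply: circle_in; first exact: expR_ge0.
  by rewrite -ltrBrDl -(@lnK _ (x - c0)) ?posrE// ltr_expR.
have lrx : ln r < ln (x - c0) by rewrite ltr_ln ?posrE//; lra.
have hw s t : s < ln (x - c0) -> exists A B A' B' : R,
    [/\ diff2 w s t A B, diff2 h s t A' B', jcont (fun _ _ => 0) s t & A' - B = 0].
  move=> sx; have [al [be [ud vd]]] := diff2_dilate (hin s t sx).
  do 4 eexists; split; [exact: vd|exact: ud| |by ring].
  exact: diff2_jcont (diff2_cst 0 s t).
have hcont s : s < ln (x - c0) -> cont_on (h s) 0 (pi *+ 2).
  move=> sx t _; apply: jcont_cont.
  by have [A [B [A' [B' [_ /diff2_jcont]]]]] := hw s t sx.
have hconst s : s <= ln r -> itg (h (ln r)) 0 (pi *+ 2) = itg (h s) 0 (pi *+ 2).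
  move=> sr; apply/eqP; rewrite -subr_eq0 -itgB; last 2 first.
  - exact: hcont.
  - by apply: hcont; exact: le_lt_trans lrx.
  (* The curl is zero, and [w] takes the same values at [t = 0] and [t = 2 pi], so the right side of
     Green's identity vanishes. *)
  rewrite (@green_rectangle R (s - 1) (ln (x - c0)) w h (fun _ _ => 0))//; last 2 first.
  - by move=> y t /andP[_ yx]; exact: hw.
  - by rewrite ltrBlDr ltrDl.
  have i0 a b : a <= b -> itg (fun=> 0) a b = 0 :> R.
    by move=> ab; rewrite itg_cst// mul0r.
  rewrite (i0 _ _ pi20) (i0 _ _ sr) addr0 (@eq_itg _ _ (fun=> 0)) ?i0//.
  by move=> y _; rewrite /w cos2pi sin2pi cos0 sin0 subrr.
have -> : circle_coef r 0 x = itg (h (ln r)) 0 (pi *+ 2).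
  apply: eq_itg => t _; rewrite /circle_re /h lnK ?posrE// mul0r cos0 sin0.
  by rewrite mulr1 mulr0 addr0.
apply/eqP; rewrite -subr_eq0 -normr_le0; apply/ler_addgt0Pl => e e0.
rewrite addr0.
have K0 : 0 < pi *+ 2 :> R by rewrite pmulrn_lgt0// pi_gt0.
have cx' : c0 < x by lra.
have [al [be [ud _]]] := derivable_cauchy_riemann (@Fhol _ 0 cx').
have [d d0 H] := diff2_jcont ud (divr_gt0 e0 K0).
(* The circle of radius [e^s] is no larger than the given one and lies where [u] is within
   [e / (2 pi)] of its value at the centre. *)
pose s := Num.min (ln r) (ln d).
have sr : s <= ln r by rewrite ge_min lexx.
have sd : expR s <= d by rewrite -[leRHS]lnK ?posrE// ler_expR ge_min lexx orbT.
have es0 := expR_ge0 s.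
rewrite (hconst s sr); have -> : e = e / (pi *+ 2) * (pi *+ 2 - 0).
  by rewrite subr0 divfK// gt_eqF.
rewrite -[X in u x 0 * X]subr0; apply: itg_near_cst => //.
  by apply: hcont; exact: le_lt_trans lrx.
move=> t _; apply: H; rewrite ?subr0.
  rewrite addrAC subrr add0r normrM ger0_norm// (le_trans _ sd)// ler_piMr//.
  by rewrite ler_norml cos_geN1 cos_le1.
rewrite normrM ger0_norm// (le_trans _ sd)// ler_piMr//.
by rewrite ler_norml sin_geN1 sin_le1.
Qed.

Lemma circle_coef_le r k x (M : R) : 0 < r -> c0 + r < x ->
  (forall t, cabs (F ((x + r * cos t) +i* (r * sin t))) <= M) ->
  `|circle_coef r k x| <= M * (pi *+ 2).
Proof.
move=> r0 cx FM; rewrite -[X in `|X|]subr0 -(mul0r (pi *+ 2 - 0)) -[X in M * X]subr0.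
apply: itg_near_cst => //; first exact: circle_re_cont (ltW r0) cx.
move=> t _; rewrite subr0; apply: le_trans (FM t).
rewrite /circle_re /u /v; case: (F _) => a b /=.
have := cos2Dsin2 (k%:R * t); move: (cos _) (sin _) => c s cs.
rewrite -sqrtr_sqr ler_wsqrtr//.
(* Multiplication by [e^(-ikt)] preserves the modulus; the first square is that of the real part. *)
have -> : a ^+ 2 + b ^+ 2 = (a * c + b * s) ^+ 2 + (a * s - b * c) ^+ 2.
  by rewrite -[LHS]mulr1 -cs; ring.
by rewrite lerDl sqr_ge0.
Qed.

Section real_axis.
Variable f : R -> R.
Hypothesis Ff : forall x : R, F x%:C = (f x)%:C.

(** The case [k = 0] is the mean value property, and differentiating the coefficient gives the
    induction step. The formula holds only right of [c0 + r], so derivatives are compared through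
    equality near [x]. *)
Lemma derive1n_circle_coef r k x : 0 < r -> c0 + r < x ->
  (derive1n k f) x = k`!%:R / (r ^+ k * (pi *+ 2)) * circle_coef r k x.
Proof.
move=> r0; have K0 : (pi *+ 2 : R) != 0 by rewrite gt_eqF// pmulrn_lgt0// pi_gt0.
elim: k x => [|k IH] x cx.
  rewrite derive1n0 circle_mean// /u [x +i* 0](_ : _ = x%:C)// Ff/=.
  by rewrite expr0 fact0; move: (pi *+ 2) K0 => p p0; field.
rewrite derive1nS derive1E.
have D : is_derive x 1 (fun y => k`!%:R / (r ^+ k * (pi *+ 2)) * circle_coef r k y)
    (k`!%:R / (r ^+ k * (pi *+ 2)) * (k.+1%:R / r * circle_coef r k.+1 x)).
  by apply: is_deriveZ; exact: is_derive_circle_coef.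
have [_ ->] : is_derive x 1 (derive1n k f)
    (k`!%:R / (r ^+ k * (pi *+ 2)) * (k.+1%:R / r * circle_coef r k.+1 x)).
  apply: near_eq_is_derive D.
  have : \forall y \near x, c0 + r < y by exact: lt_nbhsr.
  by apply: filterS => y cy; rewrite IH.
rewrite factS natrM exprS.
move: (pi *+ 2) K0 => p p0; field.
by rewrite p0 expf_neq0 gt_eqF.
Qed.

Lemma cauchy_estimate r k x (M : R) : 0 < r -> c0 + r < x ->
  (forall t, cabs (F ((x + r * cos t) +i* (r * sin t))) <= M) ->
  `|(derive1n k f) x| <= k`!%:R * M / r ^+ k.
Proof.
move=> r0 cx /(circle_coef_le k r0 cx) H; rewrite (derive1n_circle_coef k r0 cx).
have K0 : 0 < (pi *+ 2 : R) by rewrite pmulrn_lgt0// pi_gt0.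
have rk : 0 < r ^+ k by rewrite exprn_gt0.
rewrite normrM ger0_norm ?divr_ge0 ?mulr_ge0 ?(ltW K0) ?(ltW rk)//.
apply: le_trans (ler_wpM2l _ H) _; first by rewrite divr_ge0 ?mulr_ge0 ?ltW.
by rewrite le_eqVlt; apply/orP; left; apply/eqP;
  move: (pi *+ 2) K0 => p p0; field; rewrite !gt_eqF.
Qed.

End real_axis.

End circle_means.

(** * Integral bounds outside a negligible set *)

Section integral_bounds.
Variables (d : measure_display) (T : measurableType d) (R : realType).
Variable mu : {measure set T -> \bar R}.

Local Open Scope ereal_scope.

Import HBNNSimple.

(** Every simple function below [f] on [D] is below [g], and both integrals are suprema over such
    functions. *)
Lemma ge0_le_integral_nomeas (D : set T) (f g : T -> \bar R) :
  (forall x, D x -> 0 <= f x) -> (forall x, D x -> f x <= g x) ->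
  \int[mu]_(x in D) f x <= \int[mu]_(x in D) g x.
Proof.
move=> f0 fg; have g0 x : D x -> 0 <= g x.
  by move=> Dx; apply: le_trans (f0 _ Dx) (fg _ Dx).
rewrite !ge0_integralE//= ge_ereal_sup// => _ [h/= hfD] <-.
apply: ereal_sup_ubound; exists h => //= x; apply: le_trans (hfD x) _.
by rewrite /patch; case: ifPn => // /[!inE] /fg.
Qed.

(* No measurability of [f] is needed, since the integral of a nonnegative
   function is a supremum over the simple functions below it. *)
Lemma ae_le_normr_Rintegral (D N : set T) (f b : T -> R) :
  measurable D -> mu.-integrable D (EFin \o b) ->
  (forall x, D x -> (0 <= b x)%R) -> mu.-negligible N ->
  (forall x, D x -> ~ N x -> (`|f x| <= b x)%R) ->
  (`|\int[mu]_(x in D) f x| <= \int[mu]_(x in D) b x)%R.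
Proof.
move=> mD ib b0 [A [mA A0 NA]] fb.
(* Raising [b] to [+oo] on the null set makes the bound hold everywhere on [D] without changing its
   integral. *)
pose b' x : \bar R := if x \in A then +oo else (b x)%:E.
have b'0 x : D x -> 0 <= b' x.
  by move=> Dx; rewrite /b'; case: ifPn => // _; rewrite lee_fin b0.
have mb := measurable_int mu ib.
have mb' : measurable_fun D b'.
  apply: measurable_fun_if => //.
  - apply: (measurable_fun_bool true); rewrite (_ : _ @^-1` _ = A).
      exact: measurableI.
    by apply/seteqP; split => x /=; [exact: set_mem|exact: mem_set].
  - by apply: measurable_funS mb => // x [].
have bE : \int[mu]_(x in D) b' x = \int[mu]_(x in D) (b x)%:E.
  apply: ge0_ae_eq_integral => //; exists A; split=> // x /= /not_implyP[Dx].
  by apply: contra_notP => nAx; rewrite /b' memNset.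
have bfin : \int[mu]_(x in D) (b x)%:E \is a fin_num by exact: integrable_fin_num.
have fle x : D x -> `|(f x)%:E| <= b' x.
  move=> Dx; rewrite /b'; case: ifPn => [_|nA]; first by rewrite leey.
  by rewrite /= lee_fin fb// => /NA /mem_set; exact/negP.
have pB : \int[mu]_(x in D) ((EFin \o f)^\+ x) <= \int[mu]_(x in D) (b x)%:E.
  rewrite -bE; apply: ge0_le_integral_nomeas => x Dx; first exact: funepos_ge0.
  apply: le_trans (fle x Dx); rewrite funeposE ge_max.
  by apply/andP; split; [exact: lee_abs|exact: abse_ge0].
have nB : \int[mu]_(x in D) ((EFin \o f)^\- x) <= \int[mu]_(x in D) (b x)%:E.
  rewrite -bE; apply: ge0_le_integral_nomeas => x Dx; first exact: funeneg_ge0.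
  apply: le_trans (fle x Dx); rewrite funenegE ge_max -abseN.
  by apply/andP; split; [exact: lee_abs|exact: abse_ge0].
have p0 : 0 <= \int[mu]_(x in D) ((EFin \o f)^\+ x).
  by apply: integral_ge0 => x _; exact: funepos_ge0.
have n0 : 0 <= \int[mu]_(x in D) ((EFin \o f)^\- x).
  by apply: integral_ge0 => x _; exact: funeneg_ge0.
rewrite /Rintegral integralE; move: p0 n0 pB nB; rewrite -(fineK bfin).
case: (integral _ _ _) => [p||]//; case: (integral _ _ _) => [n||]//.
rewrite !lee_fin => p0 n0 pB nB.
by rewrite /= ler_norml; lra.
Qed.

End integral_bounds.

(** The image of Lebesgue measure under the affine map, scaled by [c], agrees with Lebesgue measure
    on half-open intervals and so on all measurable sets. *)
Lemma affine_preimage_negligible (R : realType) (x c : R) (N : set R) : 0 < c ->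
  (@lebesgue_measure R).-negligible N ->
  (@lebesgue_measure R).-negligible [set v | N (x + c * v)].
Proof.
move=> c0 [A [mA A0 NA]].
pose h (v : measurableTypeR R) : measurableTypeR R := x + c * v.
have mh : measurable_fun setT h.
  by apply: measurable_funD => //; exact: measurable_funM.
exists (h @^-1` A); split.
- by rewrite -[X in measurable X]setTI; exact: mh.
- pose nu := mscale (NngNum (ltW c0)) (pushforward (@lebesgue_measure R) h).
  have : lebesgue_measure A = nu mh A.
    apply: lebesgue_measure_unique => //= _ [[a b]] _ <-.
    rewrite /nu /mscale /= /pushforward.
    rewrite (_ : h @^-1` _ = `](a - x) / c, (b - x) / c]%classic); last first.
      apply/seteqP; split => v /=; rewrite !in_itv/= /h.
        by rewrite ltr_pdivrMr// ler_pdivlMr// !(mulrC v); lra.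
      by rewrite ltr_pdivrMr// ler_pdivlMr// !(mulrC v); lra.
    rewrite !lebesgue_measure_itv/= !lte_fin ltr_pM2r ?invr_gt0// ltrD2r.
    case: ifPn => _; last by rewrite mule0.
    by rewrite -!EFinB -EFinM; congr EFin; field; rewrite gt_eqF.
  rewrite A0 /nu /mscale /= /pushforward => /esym/eqP.
  by rewrite mule_eq0 eqe gt_eqF//= => /eqP.
- by move=> v /= /NA.
Qed.

(** * Bounds on the derivatives in the half plane *)

(** Right of [a0], [h] is a constant plus the integral of [g] from [a0], which Lebesgue's theorem
    differentiates almost everywhere. *)
Lemma RN_derivative_ae (R : realType) (h g : R -> R) (a0 : R) :
  RN_derivative h g ->
  (@lebesgue_measure R).-negligible [set x | a0 < x /\ h^`()%classic x <> g x].
Proof.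
case=> lg hg; have [mg _ fing] := lg.
have ig y : (@lebesgue_measure R).-integrable
    [set` Interval (BLeft a0) (BRight y)] (EFin \o g).
  apply/integrableP; split; first by apply/measurable_EFinP; exact: measurable_funS mg.
  by apply: fing => //; exact: segment_compact.
have := FTC1 ig lg; apply: negligibleS => x /= [ax hx] /(_ _)[].
  by rewrite lte_fin.
move=> dF Fx; apply: hx; rewrite -Fx !derive1E.
apply/esym; rewrite -[RHS]addr0.
have -> : 'D_1 h x = 'D_1 (fun y => h a0 +
    \int[lebesgue_measure]_(t in [set` Interval (BLeft a0) (BRight y)]) g t) x.
  apply: near_eq_derive; have : \forall y \near x, a0 < y by exact: lt_nbhsr.
  by apply: filterS => y ay; rewrite -hg ?ltW// addrC subrK.
by rewrite deriveD// derive_cst add0r addr0.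
Qed.

Lemma interior_half_plane (R : realType) (a : R) (z : R[i]^o) :
  - a < complex.Re z -> (half_plane a)° z.
Proof.
move=> az; have e0 : 0 < complex.Re z + a by lra.
apply/nbhs_ballP; exists (complex.Re z + a)%:C => /=; first by rewrite ltcR.
move=> w; rewrite /ball/= normE_cabs ltcR /half_plane/= => zw.
have := le_lt_trans (Re_le_normc (z - w)) zw.
by case: z w {az e0 zw} => [x y] [x' y'] /=; rewrite ltr_norml; lra.
Qed.

Section half_plane_bound.
Variables (R : realType) (a mu lam : R) (f : R -> R) (F : R[i]^o -> R[i]^o).
Hypothesis hF : holo_extension a f F.
Hypotheses (hmu : 0 <= mu) (hlam : 0 <= lam).
Hypothesis hbound : forall z : R[i]^o, half_plane a z ->
  cabs (F z) <= mu * cabs (z + a%:C + 1) `^ lam.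

Let Fhol (x y : R) : - a < x -> derivable F (x +i* y) 1.
Proof. by case: hF => _ _ Fh ax; apply: Fh; exact: interior_half_plane. Qed.

Let circle_bound (x r t : R) : 1 <= x + a -> 0 < r -> r < x + a ->
  cabs (F ((x + r * cos t) +i* (r * sin t))) <= mu * (3 * (x + a)) `^ lam.
Proof.
move=> xa r0 rx; have hc : - r <= r * cos t.
  by rewrite -[leLHS]mulr1 mulNr -mulrN ler_wpM2l ?(ltW r0)// cos_geN1.
apply: le_trans (hbound _) _; first by rewrite /half_plane/=; lra.
rewrite ler_wpM2l// ge0_ler_powR ?nnegrE ?cabs_ge0//; first by lra.
rewrite (_ : _ + _ + _ = (x + a + 1) +i* 0 + (r * cos t) +i* (r * sin t)); last first.
  by apply/eqP; rewrite eq_complex/=; apply/andP; split; apply/eqP; ring.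
apply: le_trans (le_normcD _ _) _.
have -> : cabs ((r * cos t) +i* (r * sin t)) = r.
  rewrite /ComplexField.Normc.normc !exprMn -mulrDr cos2Dsin2 mulr1.
  by rewrite sqrtr_sqr gtr0_norm.
have -> : cabs ((x + a + 1) +i* 0) = x + a + 1.
  rewrite /ComplexField.Normc.normc expr0n/= addr0 sqrtr_sqr ger0_norm//; lra.
lra.
Qed.

Lemma half_plane_derive_bound k x : 1 <= x + a ->
  `|derive1n k f x| <= k`!%:R * mu * 3 `^ lam * (x + a) `^ (lam - k%:R).
Proof.
move=> xa; have xa0 : 0 < x + a by lra.
have Ff : forall y : R, F y%:C = (f y)%:C by case: hF.
set K := k`!%:R * (mu * (3 * (x + a)) `^ lam).
have H r : 0 < r -> r < x + a -> `|derive1n k f x| * r ^+ k <= K.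
  move=> r0 rx; rewrite -ler_pdivlMr ?exprn_gt0//.
  apply: (cauchy_estimate Fhol Ff _ r0); first by lra.
  by move=> t; exact: circle_bound.
(* The circle of radius [x + a] touches the edge of the half plane. As [K] does not depend on [r], a
   limit from the left reaches this radius. *)
have {}H : `|derive1n k f x| * (x + a) ^+ k <= K.
  rewrite leNgt; apply/negP => Kx.
  have : (fun r => `|derive1n k f x| * r ^+ k) r @[r --> (x + a : R)] -->
      `|derive1n k f x| * (x + a) ^+ k.
    by apply: cvgMr; exact: exprn_continuous.
  move=> /cvgr_gt /(_ _ Kx) nK.
  near ((x + a)^'-) => r.
  have : K < `|derive1n k f x| * r ^+ k by near: r; exact: cvg_at_left_filter nK.
  apply/negP; rewrite -leNgt; apply: H; near: r; last exact: nbhs_left_lt.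
  exact: nbhs_left_gt.
rewrite powRB; last by rewrite (gt_eqF xa0) implybT.
rewrite powR_mulrn ?(ltW xa0)// mulrA ler_pdivlMr ?exprn_gt0//.
by move: H; rewrite /K powRM ?(ltW xa0)// !mulrA.
Unshelve. all: by end_near. Qed.

End half_plane_bound.

(** * Sums of powers *)

Section midpoint_sum.
Variable R : realType.
Implicit Types (p s t u y b : R).

(** A convex function lies above its tangent at [y]; here this follows from [1 + w <= e^w] and
    [ln w <= w - 1]. *)
Lemma powR_tangent s y u : 0 <= s -> 0 < y -> 0 < u ->
  y `^ (- s) * (1 - s * (u / y - 1)) <= u `^ (- s).
Proof.
move=> s0 y0 u0; have uy : 0 < u / y by rewrite divr_gt0.
have -> : u `^ (- s) = y `^ (- s) * (u / y) `^ (- s).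
  by rewrite -powRM ?ltW// mulrCA divff ?mulr1// gt_eqF.
rewrite ler_wpM2l ?powR_ge0// /powR gt_eqF//.
apply: le_trans (expR_ge1Dx _); rewrite mulNr lerD2l lerN2 ler_wpM2l//.
have := @le_ln1Dx R (u / y - 1); rewrite addrCA subrr addr0; apply.
by rewrite ltrBrDl subrr.
Qed.

(** In the sum of the tangent bounds at [y - t] and [y + t] the linear terms cancel. *)
Lemma powR_midpoint s y t : 0 <= s -> `|t| < y ->
  2 * y `^ (- s) <= (y - t) `^ (- s) + (y + t) `^ (- s).
Proof.
rewrite ltr_norml => s0 /andP[ty yt]; have y0 : 0 < y by lra.
have h1 := @powR_tangent s y (y - t) s0 y0 _.
have h2 := @powR_tangent s y (y + t) s0 y0 _.
apply: le_trans (lerD (h1 _) (h2 _)); [|lra|lra].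
by rewrite le_eqVlt; apply/orP; left; apply/eqP; field; rewrite gt_eqF.
Qed.

(** The midpoint rule underestimates the integral of a convex function. The difference [g] vanishes
    at 0 and its derivative is nonnegative by [powR_midpoint]; the claim is its sign at [1 / 2]. *)
Lemma powR_telescope p y : 0 < p -> 1 / 2 < y ->
  p * y `^ (- p - 1) <= (y - 1 / 2) `^ (- p) - (y + 1 / 2) `^ (- p).
Proof.
move=> p0 y2.
pose g t := (y - t) `^ (- p) - (y + t) `^ (- p) - 2 * p * y `^ (- p - 1) * t.
pose g' t := - p * (y - t) `^ (- p - 1) * (- 1) - - p * (y + t) `^ (- p - 1) * 1 -
  2 * p * y `^ (- p - 1) * 1.
have dg t : 0 <= t <= 1 / 2 -> is_derive t 1 g (g' t).
  move=> t2; apply: is_deriveB; first apply: is_deriveB.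
  - apply: (@is_derive1_comp _ (fun x : R => x `^ (- p)) (fun t => y - t)).
      by apply: is_derive1_powR; lra.
    rewrite -[X in is_derive _ _ _ X]add0r.
    by apply: is_deriveD.
  - apply: (@is_derive1_comp _ (fun x : R => x `^ (- p)) (fun t => y + t)).
      by apply: is_derive1_powR; lra.
    rewrite -[X in is_derive _ _ _ X]add0r.
    by apply: is_deriveD.
have le02 : 0 <= 1 / 2 :> R by lra.
have dg' (x : R) : x \in `]0, 1 / 2[ -> is_derive x 1 g (g' x).
  by rewrite in_itv/= => x2; apply: dg; lra.
have cg : {within `[0, 1 / 2], continuous g}.
  by apply: derivable_within_continuous => x; rewrite in_itv/= => x2; have [] := dg x x2.
have [c] := MVT_segment le02 dg' cg.
rewrite in_itv/= => c2; rewrite {1 2}/g subr0 addr0 subrr sub0r mulr0 oppr0 !subr0.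
have cy : `|c| < y by rewrite ltr_norml; lra.
have sp : 0 <= p + 1 by lra.
have := powR_midpoint sp cy; rewrite opprD => mid.
have : 0 <= g' c * (1 / 2).
  rewrite mulr_ge0//.
  have -> : g' c = p * ((y - c) `^ (- p - 1) + (y + c) `^ (- p - 1) -
      2 * y `^ (- p - 1)) by rewrite /g'; ring.
  by rewrite mulr_ge0 ?subr_ge0// ltW.
by rewrite addr0 => + E; rewrite -E; lra.
Qed.

Lemma sum_powR_le p b n : 0 < p -> 1 / 2 < b ->
  \sum_(0 <= k < n) (k%:R + b) `^ (- p - 1) <= (b - 1 / 2) `^ (- p) / p.
Proof.
move=> p0 b2; rewrite ler_pdivlMr//.
(* The subtracted end term makes the induction telescope. *)
suff : (\sum_(0 <= k < n) (k%:R + b) `^ (- p - 1)) * p <=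
    (b - 1 / 2) `^ (- p) - (n%:R + b - 1 / 2) `^ (- p).
  by move/le_trans; apply; rewrite gerBl powR_ge0.
elim: n => [|n IH]; first by rewrite big_geq// mul0r add0r subrr.
rewrite big_nat_recr//= mulrDl.
have nb : 1 / 2 < n%:R + b by rewrite (lt_le_trans b2)// lerDr.
have := powR_telescope p0 nb.
have -> : n.+1%:R + b - 1 / 2 = n%:R + b + 1 / 2 by rewrite -[n.+1%:R]natr1; field.
by rewrite (mulrC p); lra.
Qed.

End midpoint_sum.

(** * Numerical bounds *)

(** The cosine is positive at half of the stated value, by its Taylor polynomial of degree ten, but
    would be at most [cos (pi / 2) = 0] if [pi / 2] did not exceed that half. *)
Lemma pi_gt_314151 (R : realType) : 3 + 141 / 10 ^+ 3 + 51 / 10 ^+ 5 < pi :> R.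
Proof.
pose a : R := (3 + 141 / 10 ^+ 3 + 51 / 10 ^+ 5) / 2.
have a0 : 0 < a by rewrite /a; lra.
have a2 : a < 2 by rewrite /a; lra.
have signE (k : nat) : ((-1) ^ k%:Z : R) = (-1) ^+ k by [].
have cosa : 0 < cos a.
  rewrite -(cvg_lim (@Rhausdorff R) (@cvg_cos_coeff' R a)).
  apply: lt_trans (lt_sum_lim_series (n := 6) _ _).
  - rewrite !big_nat_recr//= big_nil /cos_coeff' !signE !doubleS !factS double0 fact0.
    rewrite !natrM.
    set S := (X in _ < X).
    have -> : S = 1 - a ^+ 2 / 2 * (1 - a ^+ 2 / 12 * (1 - a ^+ 2 / 30 *
        (1 - a ^+ 2 / 56 * (1 - a ^+ 2 / 90)))).
      by rewrite /S; field.
    rewrite /a; lra.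
  - by have /cvgP := @cvg_cos_coeff' R a.
  (* The terms beyond the polynomial are taken in pairs, each positive since
     [a^2 < 4 <= (2N + 1) (2N + 2)]. *)
  move=> d; rewrite addnS /cos_coeff' !signE; set N := (6 + d.*2)%N.
  have /negbTE oN : ~~ odd N by rewrite oddD odd_double.
  have N0 : (0 < N)%N by [].
  clearbody N; rewrite exprS -signr_odd oN expr0 mulr1 mul1r mulN1r mulNr subr_gt0.
  rewrite doubleS !factS !natrM !exprS ltr_pdivrMr ?mulr_gt0 ?ltr0n ?fact_gt0//.
  have fN : (N.*2`!%:R : R) != 0 by rewrite pnatr_eq0 -lt0n fact_gt0.
  have E (p q r s : R) : q != 0 -> p / q * (r * (s * q)) = r * s * p.
    by move=> q0; field.
  rewrite E//.
  rewrite mulrA ltr_pM2r ?exprn_gt0//.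
  have : a * a < 2 * 2 :> R by rewrite ltr_pM// ltW.
  have : (4%:R : R) <= N.*2.+2%:R * N.*2.+1%:R by rewrite -natrM ler_nat; nia.
 
  lra.
suff : a < pi / 2 by rewrite /a; lra.
rewrite ltNge; apply/negP => pa.
have := pi_ge2 R => pi2; have pi0 := pi_gt0 R.
have : cos a <= cos (pi / 2).
  by rewrite leNgt ltr_cos ?in_itv/= -?leNgt //; lra.
by rewrite cos_pihalf leNgt cosa.
Qed.

(** * The weights and the maximum of [Lambda] *)

Section weights.
Variable R : realType.
Implicit Types (y t : R) (m : nat).

(* Equality holds at [t = m / y]. *)
Lemma expr_le_expR t m y : (0 < m)%N -> 0 < y -> 0 <= t ->
  t ^+ (2 * m) <= (m%:R / (expR 1 * y)) ^+ (2 * m) * expR (2 * y * t).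
Proof.
move=> m0 y0 t0; have mR : 0 < m%:R :> R by rewrite ltr0n.
have e0 : 0 < expR 1 :> R := expR_gt0 1.
pose s := y * t / m%:R.
have es : expR 1 * s <= expR s.
  have := @expR_ge1Dx R (s - 1); rewrite addrCA subrr addr0 expRB.
  by rewrite ler_pdivlMr// mulrC.
have -> : expR (2 * y * t) = expR s ^+ (2 * m).
  by rewrite -expRM_natl natrM; congr expR; rewrite /s; field; rewrite gt_eqF.
rewrite -exprMn; apply: lerXn2r.
- by rewrite nnegrE.
- by rewrite nnegrE mulr_ge0 ?expR_ge0// divr_ge0 ?mulr_ge0 ?ltW.
have -> : t = m%:R / (expR 1 * y) * (expR 1 * s).
  by rewrite /s; field; rewrite !gt_eqF.
by rewrite ler_wpM2l// divr_ge0 ?mulr_ge0 ?ltW.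
Qed.

(** This is the upper half of the binomial expansion: the term of index [m + j] has exponent
    [(m + j) y - (m - j) y = 2 j y], and the terms left out are nonnegative. *)
Lemma sum_bin_expR_le m y :
  \sum_(1 <= j < m.+1) 'C(2 * m, m + j)%:R * expR (2 * y * j%:R) <=
  (expR y + expR (- y)) ^+ (2 * m).
Proof.
rewrite addrC exprDn.
rewrite -(big_mkord xpredT (fun i => expR (- y) ^+ (2 * m - i) * expR y ^+ i *+ 'C(2 * m, i))).
have m2 : (m.+1 <= (2 * m).+1)%N by lia.
rewrite (big_cat_nat (leq0n m.+1) m2)/=.
rewrite [leRHS]addrC; apply: ler_wpDr.
  apply: sumr_ge0 => i _; apply: mulrn_wge0.
  by rewrite mulr_ge0// exprn_ge0// expR_ge0.
rewrite -{2}[m.+1]add1n big_addn (_ : ((2 * m).+1 - m = m.+1)%N); last by lia.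
rewrite le_eqVlt; apply/orP; left; apply/eqP.
apply: eq_big_nat => j /andP[j1 jm].
rewrite (addnC m j) -[RHS]mulr_natl; congr (_ * _).
rewrite -!expRM_natl -expRD; congr expR.
have -> : (2 * m - (j + m) = m - j)%N by lia.
by rewrite natrB ?natrD//; ring.
Qed.

Lemma sum_bin_exprn_le m y : (0 < m)%N -> 0 < y ->
  \sum_(1 <= j < m.+1) 'C(2 * m, m + j)%:R * j%:R ^+ (2 * m) <=
  4 ^+ m * m%:R ^+ (2 * m) * (((expR y + expR (- y)) / (2 * (expR 1 * y))) ^+ 2) ^+ m.
Proof.
move=> m0 y0; have e0 : 0 < expR 1 :> R := expR_gt0 1.
set K := m%:R / (expR 1 * y).
have K0 : 0 <= K by rewrite divr_ge0// mulr_ge0// ltW.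
apply: (@le_trans _ _ (K ^+ (2 * m) * (expR y + expR (- y)) ^+ (2 * m))).
  apply: le_trans (ler_wpM2l _ (sum_bin_expR_le m y)); last by rewrite exprn_ge0.
  rewrite big_distrr/=; apply: ler_sum_nat => j _.
  by rewrite mulrCA ler_wpM2l// expr_le_expR.
have -> : (4 : R) = 2 ^+ 2 by ring.
rewrite -!exprM -!exprMn le_eqVlt; apply/orP; left; apply/eqP; congr (_ ^+ _).
by rewrite /K; field; rewrite !gt_eqF.
Qed.

(** The equation [y = coth y] is the critical point equation of [cosh y / y], the factor to be made
    small in [sum_bin_exprn_le]. Strictness of [1 < y] puts [y^-1] in the domain of [Lambda]. *)
Lemma exists_coth_fixpoint : exists2 y : R, 1 < y &
  y * (expR y - expR (- y)) = expR y + expR (- y).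
Proof.
pose h y : R := y * (expR y - expR (- y)) - (expR y + expR (- y)).
have hd (x : R) : derivable h x 1.
  have dN : derivable (fun x : R => expR (- x)) x 1.
    by apply: (@ex_derive _ _ _ _ _ _ _ (is_derive1_comp _ _)).
  have dE := @derivable_expR R x.
  exact: (derivableB (derivableM (@derivable_id _ _ x 1) (derivableB dE dN)) (derivableD dE dN)).
have hc : {within `[1, 2], continuous h}.
  by apply: derivable_within_continuous => x _; exact: hd.
have h1 : h 1 < 0.
  by have := expR_gt0 (- 1 : R); rewrite /h; lra.
have h2 : 0 <= h 2.
  have a : 3 <= expR 2 :> R by have := @expR_ge1Dx R 2; lra.
  have b : expR (- 2) <= 1 :> R by rewrite expR_le1; lra.
  by rewrite /h; lra.
have [|y] := @IVT R h 1 2 0 (ler1n R 2) hc.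
  by rewrite (min_idPl _) ?(max_idPr _) ?h2 ?(ltW h1)// (le_trans (ltW h1)).
rewrite in_itv/= => /andP[y1 y2] hy; exists y.
  rewrite lt_neqAle y1 andbT; apply/eqP => yE.
  by move: h1; rewrite yE hy ltxx.
by apply/eqP; rewrite -subr_eq0 -/(h y) hy.
Qed.

(* With [y tanh y = 1], both sides are [e^-2 / (y^2 - 1)]. *)
Lemma Lambda_coth_fixpoint y : 1 < y ->
  y * (expR y - expR (- y)) = expR y + expR (- y) ->
  Lambda y^-1 = ((expR y + expR (- y)) / (2 * (expR 1 * y))) ^+ 2.
Proof.
move=> y1; rewrite expRN; set E := expR y => H.
have E0 : 0 < E := expR_gt0 y.
have y0 : 0 < y by lra.
have e0 : 0 < expR 1 :> R := expR_gt0 1.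
have EE : E ^+ 2 * (y - 1) = y + 1.
  have : E * (y * (E - E^-1)) = E * (E + E^-1) by rewrite H.
  rewrite (_ : E * (y * _) = y * E ^+ 2 - y); last by field; rewrite gt_eqF.
  rewrite (_ : E * (_ + _) = E ^+ 2 + 1); last by field; rewrite gt_eqF.
  lra.
have t1 : 0 < 1 - y^-1 by rewrite subr_gt0 invf_lt1.
have t2 : 0 < 1 + y^-1 by rewrite addr_gt0// invr_gt0.
have y1' : y - 1 != 0 by rewrite gt_eqF// subr_gt0.
have y2' : y + 1 != 0 by rewrite gt_eqF//; lra.
have E2 : E ^+ 2 = (y + 1) / (y - 1) by rewrite -EE mulfK.
(* The fixed point equation says [e^(2y) = (y + 1) / (y - 1)], which eliminates one of the two
   logarithms. *)
have lE : ln (1 + y^-1) = ln (1 - y^-1) + 2 * y.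
  have -> : 1 + y^-1 = (1 - y^-1) * expR (2 * y).
    rewrite (expRM_natl 2 y) -/E.
    by rewrite E2; field; rewrite y1' gt_eqF.
  by rewrite lnM ?posrE ?expR_gt0// expRK.
rewrite /Lambda /powR !gt_eqF// -expRD lE.
have -> : (y^-1 - 1) * ln (1 - y^-1) + (-1 - y^-1) * (ln (1 - y^-1) + 2 * y) =
    - (ln (1 - y^-1) + (ln (1 - y^-1) + 2 * y)) - 2 * 1.
  by field; rewrite gt_eqF.
rewrite expRB -lE -lnM ?posrE// expRN lnK ?posrE ?mulr_gt0//.
rewrite (expRM_natl 2 1).
have Ei : E^-1 ^+ 2 = (y - 1) / (y + 1).
  by rewrite exprVn E2 invf_div.
have -> : ((E + E^-1) / (2 * (expR 1 * y))) ^+ 2 =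
    (E ^+ 2 + E^-1 ^+ 2 + 2) / (4 * expR 1 ^+ 2 * y ^+ 2).
  by field; rewrite !gt_eqF.
rewrite Ei E2; move: (expR 1) e0 => e e0.
by field; rewrite y1' y2' !gt_eqF.
Qed.

Lemma Lambda_le_max t : 0 < t < 1 -> Lambda t <= Lambda_max R.
Proof.
move=> t01; apply: ub_le_sup; last first.
  by exists t => //=; rewrite in_itv.
(* The supremum needs some upper bound: [(1 - x)^(x - 1) <= e^x <= e], and the other two factors are
   at most 1. *)
exists (expR 1) => z [x /= + <-{z}]; rewrite in_itv/= => /andP[x0 x1].
have p1 : 0 < 1 - x by lra.
rewrite /Lambda -[leRHS]mulr1; apply: ler_pM; rewrite ?sqr_ge0 ?mulr_ge0 ?powR_ge0//.
  rewrite -[leRHS]mulr1; apply: ler_pM; rewrite ?powR_ge0//.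
    rewrite /powR gt_eqF// ler_expR.
    have := @le_ln1Dx R ((1 - x)^-1 - 1); rewrite addrCA subrr addr0.
    have i0 : 0 < (1 - x)^-1 by rewrite invr_gt0.
    rewrite lnV ?posrE// => /(_ _); have -> : -1 < (1 - x)^-1 - 1 by lra.
    move=> /(_ isT) h; have : (1 - x) * - ln (1 - x) <= (1 - x) * ((1 - x)^-1 - 1).
      by rewrite ler_wpM2l// ltW.
    by rewrite mulrBr divff ?gt_eqF//; lra.
  rewrite /powR gt_eqF; last by lra.
  have l0 : 0 <= ln (1 + x) by rewrite ln_ge0//; lra.
  by rewrite -[leRHS]expR0 ler_expR -opprD mulNr oppr_le0 mulr_ge0//; lra.
by rewrite expr_le1 ?ltW.
Qed.

(** With 3 in place of [pi] this is a statement on natural numbers, by induction from [32 <= 36] at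
    [m = 2]; it fails at [m = 1]. *)
Lemma central_bin_le m : (2 <= m)%N ->
  2 * 4 ^+ m <= 3 * m%:R * 'C(2 * m, m)%:R :> R.
Proof.
rewrite -!natrM -natrX -!natrM ler_nat.
elim: m => // m IH; rewrite ltnS leq_eqVlt => /predU1P[<-//|/IH {}IH].
have B : ('C(2 * m.+1, m.+1) * m.+1 = 2 * (2 * m).+1 * 'C(2 * m, m))%N.
  have h1 := mul_bin_diag (2 * m).+2 m.
  have h2 := mul_bin_down (2 * m).+1 m.
  have -> : (2 * m.+1 = (2 * m).+2)%N by lia.
  move: h1 h2; rewrite /= (_ : ((2 * m).+1 - m = m.+1)%N); last by lia.
  by move: 'C(_.+2, _) 'C(_.+1, _) 'C(2 * m, _) => p q r; nia.
by rewrite expnS; nia.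
Qed.

Definition weight_sum m : R := \sum_(1 <= j < m.+1) `|gamma_ R m j| * j%:R ^+ (2 * m).+1.

Lemma weight_sumE m : weight_sum m = 2 / 'C(2 * m, m)%:R *
  \sum_(1 <= j < m.+1) 'C(2 * m, m + j)%:R * j%:R ^+ (2 * m).
Proof.
rewrite big_distrr/=; apply: eq_big_nat => j /andP[j1 jm].
rewrite /gamma_ normrM normrM normrX normrN1 expr1n mul1r.
rewrite !ger0_norm ?divr_ge0// exprS.
have j0 : j%:R != 0 :> R by rewrite pnatr_eq0 -lt0n.
have C0 : 'C(2 * m, m)%:R != 0 :> R by rewrite pnatr_eq0 -lt0n bin_gt0; lia.
by field; rewrite C0 j0.
Qed.

Lemma weight_sum_ge2_le m : (2 <= m)%N ->
  weight_sum m <= pi * Lambda_max R ^+ m * m%:R ^+ (2 * m).+1.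
Proof.
move=> m2; have m0 : (0 < m)%N by lia.
have [y y1 yE] := exists_coth_fixpoint.
have y0 : 0 < y by lra.
have C0 : 0 < 'C(2 * m, m)%:R :> R by rewrite ltr0n bin_gt0; lia.
have := sum_bin_exprn_le m0 y0; rewrite -Lambda_coth_fixpoint// => S.
have L0 : 0 <= Lambda y^-1 by rewrite Lambda_coth_fixpoint// sqr_ge0.
have LL : Lambda y^-1 ^+ m <= Lambda_max R ^+ m.
  have LM : Lambda y^-1 <= Lambda_max R.
    by apply: Lambda_le_max; rewrite invr_gt0 y0 invf_lt1.
  by rewrite lerXn2r ?nnegrE// (le_trans L0).
rewrite weight_sumE.
apply: le_trans (ler_wpM2l _ S) _; first by rewrite divr_ge0.
have -> : 2 / 'C(2 * m, m)%:R * (4 ^+ m * m%:R ^+ (2 * m) * Lambda y^-1 ^+ m) =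
    (2 * 4 ^+ m / 'C(2 * m, m)%:R) * Lambda y^-1 ^+ m * m%:R ^+ (2 * m).
  by field; rewrite gt_eqF.
rewrite exprS -!mulrA [X in _ <= _ * X]mulrCA !mulrA ler_wpM2r ?exprn_ge0//.
have pi3 : 3 <= pi :> R.
  by have := pi_gt_314151 R; lra.
apply: (@le_trans _ _ (3 * m%:R * Lambda y^-1 ^+ m)).
  rewrite ler_wpM2r ?exprn_ge0// ler_pdivrMr//; exact: central_bin_le.
by apply: ler_pM; rewrite ?mulr_ge0 ?exprn_ge0//; apply: ler_wpM2r.
Qed.

(** The point [5 / 6] is close to the maximiser of [Lambda], and the exponents there are multiples
    of [1 / 6], so the sixth power of the value is rational. *)
Lemma weight_sum1_le : weight_sum 1 <= (1 + 331 / 10 ^+ 4) * pi * Lambda_max R.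
Proof.
have -> : weight_sum 1 = 1.
  by rewrite weight_sumE big_nat1 muln1 binn bin1 expr1n; field.
have L := @Lambda_le_max (5 / 6) _.
set X := Lambda (5 / 6 : R) in L.
have X6 : X ^+ 6 = 6 * (6 / 11) ^+ 11 * (25 / 36) ^+ 6.
  have A : ((1 - 5 / 6 : R) `^ (5 / 6 - 1)) ^+ 6 = 6.
    rewrite -powR_mulrn ?powR_ge0// -powRrM.
    rewrite (_ : (5 / 6 - 1) * 6%:R = - 1 :> R); last by field.
    by rewrite powR_inv1; [field|lra].
  have B : ((1 + 5 / 6 : R) `^ (- 1 - 5 / 6)) ^+ 6 = (6 / 11) ^+ 11.
    rewrite -powR_mulrn ?powR_ge0// -powRrM.
    rewrite (_ : (- 1 - 5 / 6) * 6%:R = - 11%:R :> R); last by field.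
    rewrite powRN powR_mulrn; last by lra.
    rewrite (_ : 1 + 5 / 6 = 11 / 6 :> R); last by field.
    by rewrite -invf_div exprVn invrK.
  rewrite /X /Lambda exprMn exprMn A B.
  by rewrite (_ : (5 / 6) ^+ 2 = 25 / 36 :> R)//; field.
have X0 : 0 <= X by rewrite !mulr_ge0 ?powR_ge0 ?sqr_ge0.
set c : R := 1 + 331 / 10 ^+ 4; set q : R := 3 + 141 / 10 ^+ 3 + 51 / 10 ^+ 5.
have c0 : 0 <= c by rewrite /c; lra.
have q0 : 0 <= q by rewrite /q; lra.
apply: (@le_trans _ _ (c * q * X)).
  rewrite -(@ler_pXn2r _ 6)// ?nnegrE ?(mulr_ge0 (mulr_ge0 c0 q0) X0)// expr1n.
  rewrite 2!exprMn X6 /c /q.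
  lra.
apply: ler_pM => //; [exact: mulr_ge0| |apply: L; lra].
by rewrite ler_wpM2l// ltW// pi_gt_314151.
Qed.

End weights.

(** * Bounding the remainder *)

Lemma itg_FTC2 (R : realType) (f G : R -> R) (a b : R) : a < b ->
  continuous f -> (forall x : R, is_derive x 1 G (f x)) -> itg f a b = G b - G a.
Proof.
move=> ab fc Gd; have Gder x : derivable G x 1 by have [] := Gd x.
have Gc : continuous G.
  by move=> x; apply/differentiable_continuous/derivable1_diffP.
rewrite itgE /Rintegral (@continuous_FTC2 _ f G)//.
- exact: continuous_subspaceT.
- split=> [x _||]; first exact: Gder.
  + exact/cvg_at_right_filter/Gc.
  + exact/cvg_at_left_filter/Gc.
- by move=> x _; rewrite derive1E; have [] := Gd x.
Qed.

Lemma itg_expr (R : realType) (k : nat) (T a b : R) : a < b ->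
  itg (fun x => T * x ^+ k) a b =
  T * (b ^+ k.+1 / k.+1%:R) - T * (a ^+ k.+1 / k.+1%:R).
Proof.
move=> ab; pose G (x : R) := T * (x ^+ k.+1 / k.+1%:R).
have k0 : k.+1%:R != 0 :> R by rewrite pnatr_eq0.
have Gd (x : R) : is_derive x 1 G (T * x ^+ k).
  have := is_deriveZ (T / k.+1%:R) (is_deriveX k.+1 (is_derive_id x (1 : R))).
  rewrite (_ : _ \*: _ = G); last first.
    by apply/funext => z; rewrite /G /= /GRing.scale/= fctE; field.
  by rewrite (_ : _ *: _ = T * x ^+ k)//= /GRing.scale/= mulr1; field.
apply: (itg_FTC2 ab _ Gd) => x; apply: cvgMr; exact: exprn_continuous.
Qed.

Lemma onem_expr_continuous (R : realType) (k : nat) (T : R) :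
  continuous (fun x : R => T * (1 - x) ^+ k).
Proof.
move=> x; apply: cvgMr.
apply: (@continuous_comp _ _ _ (fun x : R => 1 - x) (fun y => y ^+ k)).
  by apply: cvgB; [exact: cvg_cst|exact: cvg_id].
exact: exprn_continuous.
Qed.

Lemma itg_onem_expr (R : realType) (k : nat) (T : R) :
  itg (fun x => T * (1 - x) ^+ k) 0 1 = T / k.+1%:R.
Proof.
pose G (x : R) := - (T / k.+1%:R) * (1 - x) ^+ k.+1.
have k0 : k.+1%:R != 0 :> R by rewrite pnatr_eq0.
have Gd (x : R) : is_derive x 1 G (T * (1 - x) ^+ k).
  have d1 : is_derive x (1 : R) (fun x : R => 1 - x) (-1).
    by rewrite -[X in is_derive _ _ _ X]add0r; apply: is_deriveB.
  have := is_deriveZ (- (T / k.+1%:R)) (is_deriveX k.+1 d1).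
  rewrite (_ : _ \*: _ = G); last first.
    by apply/funext => z; rewrite /G /= /GRing.scale/= fctE.
  by rewrite (_ : _ *: _ = T * (1 - x) ^+ k)//= /GRing.scale/=; field.
rewrite (itg_FTC2 ltr01 (@onem_expr_continuous _ k T) Gd) /G subrr subr0 expr1n.
by rewrite expr0n/= mulr0 sub0r mulr1 opprK.
Qed.

Section remainder_bound.
Variables (R : realType) (n m : nat) (f f2m : R -> R) (a mu lam : R).
Variable F : R[i]^o -> R[i]^o.
Hypotheses (hm : (1 <= m)%N).
Hypothesis hf2m : RN_derivative (derive1n (2 * m).-1 f) f2m.
Hypotheses (ha : (m%:R + 3) / 2 <= a) (hF : holo_extension a f F).
Hypotheses (hmu : 0 <= mu) (hlam0 : 0 <= lam) (hlam1 : lam < 2 * m%:R - 1).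
Hypothesis hbound : forall z : R[i]^o, half_plane a z ->
  cabs (F z) <= mu * cabs (z + a%:C + 1) `^ lam.

Let N : set R := [set x | - a < x /\ (derive1n (2 * m).-1 f)^`()%classic x <> f2m x].

Let Nnull : (@lebesgue_measure R).-negligible N := RN_derivative_ae (- a) hf2m.

Let D : R := (2 * m)`!%:R * mu * 3 `^ lam.
Let b : R := a - m%:R / 2.
(** Thus [- p - 1] is [lam - 2m], the exponent in Cauchy's estimate. *)
Let p : R := 2 * m%:R - 1 - lam.

Let D0 : 0 <= D.
Proof. by rewrite !mulr_ge0 ?powR_ge0. Qed.

Let b32 : 3 / 2 <= b.
Proof. by rewrite /b; move: ha; lra. Qed.

(** The shift [j s v / 2] is at least [- m / 2], so the point is at distance at least
    [k + b >= 3 / 2] from the edge of the half plane; the exponent is negative. *)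
Let f2m_le (k j : nat) (s v : R) : (j <= m)%N -> 0 <= s <= 1 -> -1 <= v <= 1 ->
  ~ N (k%:R + j%:R * s * v / 2) ->
  `|f2m (k%:R + j%:R * s * v / 2)| <= D * (k%:R + b) `^ (- p - 1).
Proof.
move=> jm s01 v1; set x := k%:R + _.
have jR : 0 <= (j%:R : R) <= m%:R by rewrite ler0n ler_nat.
have js : 0 <= j%:R * s <= m%:R.
  case/andP: s01 jR => s0 s1 /andP[j0 j1]; rewrite mulr_ge0//=.
  by rewrite -[leRHS]mulr1 ler_pM.
have jsv : - m%:R <= j%:R * s * v.
  case/andP: js v1 => js0 js1 /andP[v0 v1].
  have : 0 <= j%:R * s * (v + 1) by rewrite mulr_ge0//; lra.
  by rewrite mulrDr mulr1; lra.
have k0 : 0 <= k%:R :> R by rewrite ler0n.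
have xa : k%:R + b <= x + a by rewrite /x /b; lra.
have b32' := b32.
move=> nN; have <- : derive1n (2 * m) f x = f2m x.
  have -> : (2 * m = (2 * m).-1.+1)%N by rewrite prednK// muln_gt0.
  rewrite derive1nS; apply: contrapT => ne; apply: nN; split => //.
  by move: xa b32' k0; lra.
apply: le_trans (half_plane_derive_bound hF hmu hlam0 hbound _ _) _; first by lra.
rewrite -/D ler_wpM2l//.
have -> : lam - (2 * m)%:R = - (p + 1) by rewrite /p natrM; ring.
rewrite -opprD !powRN lef_pV2 ?posrE ?powR_gt0; try lra.
by apply: ge0_ler_powR; rewrite ?nnegrE//; try lra; rewrite /p; move: hlam1; lra.
Qed.

Let SB : R := \sum_(0 <= k < n) (k%:R + b) `^ (- p - 1).

Let SB0 : 0 <= SB.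
Proof. by apply: sumr_ge0 => k _; exact: powR_ge0. Qed.

Let T : R := D * SB * weight_sum R m.

Let T0 : 0 <= T.
Proof.
by rewrite !mulr_ge0//; apply: sumr_ge0 => j _; rewrite mulr_ge0.
Qed.

(** The values of [v] at which some argument of [f2m] is exceptional. The index is [j.+1] so that
    the slope is positive for [s > 0]. *)
Let N' (s : R) : set R := \bigcup_j \bigcup_k
  [set v | N ((k%:R : R) + (j.+1%:R * s / 2) * v)].

Let N'null (s : R) : 0 < s -> (@lebesgue_measure R).-negligible (N' s).
Proof.
move=> s0; apply: negligible_bigcup => j; apply: negligible_bigcup => k.
by apply: affine_preimage_negligible => //; rewrite divr_gt0// mulr_gt0.
Qed.

Let inner (s v : R) : R := v ^+ (2 * m) *
  \sum_(1 <= j < m.+1) (gamma_ R m j * j%:R ^+ (2 * m).+1 *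
    \sum_(0 <= k < n) f2m (k%:R + j%:R * s * v / 2)).

Let inner_le (s v : R) : 0 < s <= 1 -> -1 <= v <= 1 -> ~ N' s v ->
  `|inner s v| <= T * v ^+ (2 * m).
Proof.
move=> /andP[s0 s1] v1 nN; rewrite /inner mulrC normrM [`|_ ^+ _|]ger0_norm; last first.
  by rewrite exprM exprn_ge0// sqr_ge0.
apply: ler_wpM2r; first by rewrite exprM exprn_ge0// sqr_ge0.
apply: le_trans (ler_norm_sum _ _ _) _.
rewrite /T /weight_sum big_distrr/=; apply: ler_sum_nat => j /andP[j1 jm].
rewrite normrM normrM [`|_ ^+ _|]ger0_norm ?exprn_ge0// mulrC.
apply: ler_wpM2r; first by rewrite mulr_ge0.
apply: le_trans (ler_norm_sum _ _ _) _.
rewrite /SB big_distrr/=; apply: ler_sum => k _; apply: f2m_le => //.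
- by rewrite (ltW s0).
- move=> Nx; apply: nN; exists j.-1 => //; exists k => //=.
  by rewrite prednK// (_ : _ + _ = k%:R + j%:R * s * v / 2)//; ring.
Qed.

Let K : R := T * (2 / (2 * m).+1%:R).

Let K0 : 0 <= K.
Proof. by rewrite mulr_ge0// divr_ge0. Qed.

Let inner_integral_le (s : R) : 0 < s <= 1 ->
  `|\int[@lebesgue_measure R]_(v in `[-1, 1]) inner s v| <= K.
Proof.
move=> s01.
have -> : K = itg (fun v => T * v ^+ (2 * m)) (-1) 1.
  rewrite itg_expr; last by lra.
  rewrite -mulrBr expr1n -signr_odd /= oddM /= expr1 /K; congr (_ * _); ring.
rewrite itgE; apply: (@ae_le_normr_Rintegral _ _ R (@lebesgue_measure R) `[-1, 1]%classic (N' s)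
  (inner s) (fun v => T * v ^+ (2 * m))) => //.
- apply: (@cont_integrable _ (fun v => T * v ^+ (2 * m))) => x _.
  by apply: cvgMr; exact: exprn_continuous.
- by move=> v _; rewrite mulr_ge0// exprM exprn_ge0// sqr_ge0.
- by apply: N'null; case/andP: s01.
- by move=> v /=; rewrite in_itv/= => v1 nN; exact: inner_le.
Qed.

Lemma remainder_le : `|remainder n m f2m| <=
  mu * 3 `^ lam / (4 ^+ m * (2 * m%:R + 1)) * SB * weight_sum R m.
Proof.
rewrite /remainder normrM ger0_norm ?invr_ge0 ?mulr_ge0 ?exprn_ge0//.
set I := \int[_]_(s in _) _.
have I_le : `|I| <= K / (2 * m)%:R.
  have -> : K / (2 * m)%:R = itg (fun s => K * (1 - s) ^+ (2 * m).-1) 0 1.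
    by rewrite itg_onem_expr prednK// muln_gt0.
  (* The value [s = 0] is set aside: the arguments of [f2m] then do not depend on [v] and may all be
     exceptional. *)
  rewrite itgE; apply: (@ae_le_normr_Rintegral _ _ R (@lebesgue_measure R) `[0, 1]%classic [set 0]
    _ (fun s => K * (1 - s) ^+ (2 * m).-1)) => //.
  - apply: (@cont_integrable _ (fun s => K * (1 - s) ^+ (2 * m).-1)) => x _.
    exact: onem_expr_continuous.
  - move=> s /=; rewrite in_itv/= => /andP[_ s1].
    by rewrite mulr_ge0// exprn_ge0// subr_ge0.
  - by exists [set 0]; split => //; exact: lebesgue_measure_set1.
  - move=> s /=; rewrite in_itv/= => /andP[s0 s1] ns.
    rewrite normrM [`|(1 - s) ^+ _|]ger0_norm ?exprn_ge0 ?subr_ge0// mulrC.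
    apply: ler_wpM2r; first by rewrite exprn_ge0// subr_ge0.
    apply: inner_integral_le; rewrite s1 andbT lt_neqAle s0 andbT.
    by apply/eqP => /esym.
apply: le_trans (ler_wpM2l _ I_le) _.
  by rewrite invr_ge0 mulr_ge0// exprn_ge0.
rewrite le_eqVlt; apply/orP; left; apply/eqP.
have m0 : m%:R != 0 :> R by rewrite pnatr_eq0 -lt0n.
(* The factor [(2m)!] of Cauchy's estimate cancels against [(2m - 1)!] and the [2m] from the
   integral over [s]. *)
have fE : (2 * m)`!%:R = 2 * m%:R * (2 * m).-1`!%:R :> R.
  by rewrite -[in LHS](@prednK (2 * m)) ?muln_gt0// factS natrM prednK ?muln_gt0// natrM.
have f0 : (2 * m).-1`!%:R != 0 :> R by rewrite pnatr_eq0 -lt0n fact_gt0.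
have p4 : (2 : R) ^+ (2 * m).+1 = 2 * 4 ^+ m.
  by rewrite exprS exprM; congr (_ * _ ^+ _); ring.
have m21 : 2 * m%:R + 1 != 0 :> R by rewrite gt_eqF// ltr_wpDl// mulr_ge0.
have e4 : (4 : R) ^+ m != 0 by rewrite expf_neq0// pnatr_eq0.
have m1E : (2 * m).+1%:R = 2 * m%:R + 1 :> R by rewrite -[LHS]natr1 natrM.
have m2E : (2 * m)%:R = 2 * m%:R :> R by rewrite natrM.
rewrite /K /T /D fE p4 m1E m2E.
move: (_`!%:R) f0 (4 ^+ m) e4 (m%:R : R) m0 m21 => q q0 r r0 w w0 w1.
by field; rewrite q0 r0 w0 w1.
Qed.

(** The constant [c] is kept free because the weights are bounded differently for [m >= 2] and
    [m = 1]. *)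
Lemma remainder_le_weight (c : R) :
  weight_sum R m <= c * (pi * Lambda_max R ^+ m * m%:R ^+ (2 * m).+1) ->
  `|remainder n m f2m| <=
  c * pi * mu * 3 `^ lam / ((2 * m%:R + 1) * p) * (Lambda_max R / 4) ^+ m *
    (m%:R ^+ (2 * m).+1 / (a - m%:R / 2 - 1 / 2) `^ p).
Proof.
move=> W; apply: le_trans remainder_le _.
have p0 : 0 < p by rewrite /p; move: hlam1; lra.
have b2 : 1 / 2 < b by move: b32; lra.
have W0 : 0 <= weight_sum R m by apply: sumr_ge0 => j _; rewrite mulr_ge0.
have m21 : 0 < 2 * m%:R + 1 :> R by rewrite ltr_wpDl// mulr_ge0.
have e4 : 0 < (4 : R) ^+ m by rewrite exprn_gt0.
have P0 : 0 < (a - m%:R / 2 - 1 / 2) `^ p.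
  by rewrite powR_gt0//; move: b2; rewrite /b; lra.
have S := sum_powR_le n p0 b2; rewrite -/SB powRN in S.
apply: (@le_trans _ _ (mu * 3 `^ lam / (4 ^+ m * (2 * m%:R + 1)) *
    (((b - 1 / 2) `^ p)^-1 / p) * (c * (pi * Lambda_max R ^+ m * m%:R ^+ (2 * m).+1)))).
  have C0 : 0 <= mu * 3 `^ lam / (4 ^+ m * (2 * m%:R + 1)).
    by rewrite divr_ge0 ?mulr_ge0 ?powR_ge0// ltW.
  by apply: ler_pM => //; [exact: mulr_ge0|apply: ler_wpM2l].
rewrite le_eqVlt; apply/orP; left; apply/eqP; rewrite exprMn exprVn -/b.
rewrite -/b in P0; move: ((b - 1 / 2) `^ p) P0 => P P0.
move: (4 ^+ m) e4 p p0 => r r0 p' p0'.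
by field; rewrite !gt_eqF.
Qed.

End remainder_bound.

(** * The estimate in the cases [m >= 2] and [m = 1] *)

Unset Implicit Arguments.

Theorem corollary4p5 (R : realType) (n m : nat) (f f2m : R -> R)
    (a mu lam : R) (F : R[i]^o -> R[i]^o)
    (hm : (1 <= m)%N)
    (hf : C_minus (2 * m) f)
    (hf2m : RN_derivative (derive1n (2 * m).-1 f) f2m)
    (ha : (m%:R + 3) / 2 <= a)
    (hF : holo_extension a f F)
    (hmu : 0 <= mu)
    (hlam0 : 0 <= lam) (hlam1 : lam < 2 * m%:R - 1)
    (hbound : forall z : R[i]^o, half_plane a z ->
       cabs (F z) <= mu * cabs (z + a%:C + 1) `^ lam) :
  let bound (c : R) : R :=
    c * pi * mu * 3 `^ lam / ((2 * m%:R + 1) * (2 * m%:R - 1 - lam)) *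
    (Lambda_max R / 4) ^+ m *
    (m%:R ^+ (2 * m).+1 / (a - m%:R / 2 - 1 / 2) `^ (2 * m%:R - 1 - lam)) in
  ((2 <= m)%N -> `|remainder n m f2m| <= bound (1001 / 1000)) /\
  (m = 1%N -> `|remainder n m f2m| <= bound (1 + 331 / 10 ^+ 4)).
Proof.
move=> bound; have key := remainder_le_weight n hm hf2m ha hF hmu hlam0 hlam1 hbound.
split=> [m2|m1]; apply: key.
  (* This bound has constant 1, and its right side is nonnegative, so it may be enlarged by the
     factor 1.001. *)
  have W := weight_sum_ge2_le R m2.
  have W0 : 0 <= weight_sum R m by apply: sumr_ge0 => j _; rewrite mulr_ge0.
  by lra.
rewrite {1}m1; apply: le_trans (weight_sum1_le R) _.
by rewrite m1 expr1 expr1n mulr1 mulrA.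
Qed.
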